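(* The inverse 2-maxian problem on trees with $n$ vertices under the bottleneck Hamming distance, i.e. with cost function $\max_{e\in E} c_e H(x_e)$, where $H(0)=0$ and $H(\theta)=1$ for $\theta\neq 0$, can be solved in $O(n\log n)$ time.
   Context: Let $T=(V,E)$ be a tree with $|V|=n$, vertex weights $w_i\ge 0$ ($v_i \in V$) and edge lengths $\ell_e\ge 0$ ($e\in E$). A point of $T$ is a vertex or a point in the interior of an edge; $d$ is the shortest-path distance and $P(u,v)$ the path joining $u$ and $v$. A set $X=\{x_1,x_2\}$ of two points of $T$ is a 2-maxian of $T$ if it maximizes $F(X)=\sum_{i=1}^n w_i\max\{d(v_i,x_1),d(v_i,x_2)\}$ over all sets of two points of $T$. Inverse 2-maxian problem: given two prespecified leaves $a,b$ of $T$, modification bounds $\bar x_e\ge 0$ and modification costs $c_e\ge 0$ for $e\in E$, choose modifications $x_e$ with $0\le x_e\le \bar x_e$ and set new lengths $\tilde\ell_e=\ell_e+x_e$ for $e\in P(a,b)$ and $\tilde\ell_e=\ell_e-x_e$ for $e\notin P(a,b)$. The new lengths must be non-negative, and $\{a,b\}$ must be a 2-maxian of $T$ with respect to the lengths $\tilde\ell$. The goal is to minimize the given cost function of $x$. To solve the problem means to compute an optimal solution or report infeasibility. Running time is counted in elementary operations (arithmetic operations and comparisons) on the input numbers. *)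

(* Defs.v *)
From mathcomp Require Import all_boot all_order all_algebra.

Set Implicit Arguments.
Unset Strict Implicit.
Unset Printing Implicit Defensive.

Import Order.TTheory GRing.Theory Num.Theory.
Local Open Scope ring_scope.

Section Graph.
Variables (V E : finType) (ends : E -> V * V).

Definition joins (e : E) (u v : V) : bool :=
  (ends e == (u, v)) || (ends e == (v, u)).

Definition adj : rel V := fun u v => [exists e, joins e u v].

(** A 2-element [ucycle] is an edge traversed back and forth, not a cycle of
    the graph; hence the bound 2 in [tree_acyclic]. *)
Record is_tree : Prop := IsTree {
  tree_loopless : forall e, (ends e).1 != (ends e).2;
  tree_no_parallel : forall e e' u v, joins e u v -> joins e' u v -> e = e';
  tree_connected : forall u v, connect adj u v;
  tree_acyclic : forall s : seq V, ucycle adj s -> (size s <= 2)%N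
}.

Definition leaf (v : V) : bool := #|[set u | adj v u]| == 1%N.

(** As in [path], the path [u :: p] is given by its origin [u] and the sequence
    [p] of the vertices that follow. *)
Definition simple_path (u v : V) (p : seq V) : bool :=
  [&& path adj u p, last u p == v & uniq (u :: p)].

Definition path_edges (u : V) (p : seq V) : {set E} :=
  [set e | has (fun s => joins e s.1 s.2) (zip (u :: p) p)].

(** [P(u, v)]; in a tree there is exactly one simple path from [u] to [v], and
    a simple path has at most [#|V|] vertices. *)
Definition path_set (u v : V) : {set E} :=
  [set e | [exists p : {bseq #|V| of V},
              simple_path u v p && (e \in path_edges u p)]].

Section Metric.
Variables (R : realFieldType) (l : E -> R).

(** The sum of all lengths bounds the length of every simple path when
    [l >= 0], so it is a neutral default for the minimum. *)
Definition dist (u v : V) : R :=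
  \big[Num.min / \sum_e l e]_(p : {bseq #|V| of V} | simple_path u v p)
    \sum_(e in path_edges u p) l e.

(** [Inner e t] lies in the interior of [e], at distance [t] from
    [(ends e).1] along [e]. *)
Inductive point : Type := Vertex of V | Inner of E & R.

Definition is_point (x : point) : Prop :=
  match x with
  | Vertex _ => True
  | Inner e t => 0 < t < l e
  end.

Definition pdist (v : V) (x : point) : R :=
  match x with
  | Vertex u => dist v u
  | Inner e t => Num.min (dist v (ends e).1 + t)
                         (dist v (ends e).2 + (l e - t))
  end.

Definition maxian_value (w : V -> R) (x1 x2 : point) : R :=
  \sum_v w v * Num.max (pdist v x1) (pdist v x2).

Definition is_2maxian (w : V -> R) (x1 x2 : point) : Prop :=
  [/\ is_point x1, is_point x2, x1 <> x2
    & forall y1 y2 : point, is_point y1 -> is_point y2 -> y1 <> y2 ->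
        maxian_value w y1 y2 <= maxian_value w x1 x2].

End Metric.
End Graph.

Record instance (R : realFieldType) (V E : finType) := Instance {
  ends : E -> V * V;
  weight : V -> R;
  len : E -> R;
  bound : E -> R;
  ucost : E -> R;
  leaf_a : V;
  leaf_b : V
}.

Section Inverse.
Variables (R : realFieldType) (V E : finType) (I : instance R V E).

Record valid : Prop := Valid {
  valid_tree : is_tree (ends I);
  valid_weight : forall v, 0 <= weight I v;
  valid_len : forall e, 0 <= len I e;
  valid_bound : forall e, 0 <= bound I e;
  valid_ucost : forall e, 0 <= ucost I e;
  valid_leaf_a : leaf (ends I) (leaf_a I);
  valid_leaf_b : leaf (ends I) (leaf_b I);
  valid_leaf_neq : leaf_a I != leaf_b I
}.

Definition new_len (x : E -> R) (e : E) : R :=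
  if e \in path_set (ends I) (leaf_a I) (leaf_b I) then len I e + x e
  else len I e - x e.

Definition feasible (x : E -> R) : Prop :=
  [/\ forall e, 0 <= x e <= bound I e,
      forall e, 0 <= new_len x e
    & is_2maxian (ends I) (new_len x) (weight I)
        (Vertex E R (leaf_a I)) (Vertex E R (leaf_b I))].

Definition hamming (theta : R) : R := if theta == 0 then 0 else 1.

(** The default value 0 is harmless: costs are non-negative. *)
Definition bottleneck_hamming (x : E -> R) : R :=
  \big[Num.max / 0]_(e : E) (ucost I e * hamming (x e)).

Definition optimal (cost : (E -> R) -> R) (x : E -> R) : Prop :=
  feasible x /\ forall y, feasible y -> cost x <= cost y.

End Inverse.

(** A real RAM.

    Memory consists of natural-number cells (used for indices and labels) and
    of real cells, both organised in arrays: an array has a name fixed in the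
    program text and is indexed by computed naturals; scalars are cells at
    index 0.  The only flow of information from reals to naturals is through
    comparisons (no rounding).  Every constant, memory access, arithmetic or
    logical operation, comparison, assignment and branching costs one unit. *)

Inductive nexp : Type :=
  | NConst of nat
  | NGet of nat & nexp
  | NAdd of nexp & nexp
  | NSub of nexp & nexp
  | NHalf of nexp.

Inductive rexp : Type :=
  | RConst of nat
  | RGet of nat & nexp
  | RAdd of rexp & rexp
  | RSub of rexp & rexp
  | RMul of rexp & rexp
  | RDiv of rexp & rexp.

Inductive bexp : Type :=
  | BNLe of nexp & nexp
  | BRLe of rexp & rexp
  | BNot of bexp
  | BAnd of bexp & bexp.

Inductive cmd : Type :=
  | Skip
  | NSet of nat & nexp & nexp
  | RSet of nat & nexp & rexp
  | Seq of cmd & cmd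
  | If of bexp & cmd & cmd
  | While of bexp & cmd.

Fixpoint ncost (e : nexp) : nat :=
  match e with
  | NConst _ => 1
  | NGet _ i => (ncost i).+1
  | NAdd e1 e2 | NSub e1 e2 => (ncost e1 + ncost e2).+1
  | NHalf e1 => (ncost e1).+1
  end%N.

Fixpoint rcost (e : rexp) : nat :=
  match e with
  | RConst _ => 1
  | RGet _ i => (ncost i).+1
  | RAdd e1 e2 | RSub e1 e2 | RMul e1 e2 | RDiv e1 e2 =>
      (rcost e1 + rcost e2).+1
  end%N.

Fixpoint bcost (b : bexp) : nat :=
  match b with
  | BNLe e1 e2 => (ncost e1 + ncost e2).+1
  | BRLe e1 e2 => (rcost e1 + rcost e2).+1
  | BNot b1 => (bcost b1).+1
  | BAnd b1 b2 => (bcost b1 + bcost b2).+1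
  end%N.

Definition upd (T : Type) (mem : nat -> nat -> T) (a i : nat) (x : T) :
    nat -> nat -> T :=
  fun a' i' => if (a' == a) && (i' == i) then x else mem a' i'.

Section Semantics.
Variable R : realFieldType.

Record state := State { nmem : nat -> nat -> nat; rmem : nat -> nat -> R }.

Fixpoint neval (s : state) (e : nexp) : nat :=
  match e with
  | NConst k => k
  | NGet a i => nmem s a (neval s i)
  | NAdd e1 e2 => neval s e1 + neval s e2
  | NSub e1 e2 => neval s e1 - neval s e2
  | NHalf e1 => (neval s e1)./2
  end%N.

Fixpoint reval (s : state) (e : rexp) : R :=
  match e with
  | RConst k => k%:R
  | RGet a i => rmem s a (neval s i)
  | RAdd e1 e2 => reval s e1 + reval s e2
  | RSub e1 e2 => reval s e1 - reval s e2
  | RMul e1 e2 => reval s e1 * reval s e2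
  | RDiv e1 e2 => reval s e1 / reval s e2
  end.

Fixpoint beval (s : state) (b : bexp) : bool :=
  match b with
  | BNLe e1 e2 => (neval s e1 <= neval s e2)%N
  | BRLe e1 e2 => reval s e1 <= reval s e2
  | BNot b1 => ~~ beval s b1
  | BAnd b1 b2 => beval s b1 && beval s b2
  end.

(** [exec c s s' t]: started in [s], the program [c] halts in [s'] after
    [t] units of time. *)
Inductive exec : cmd -> state -> state -> nat -> Prop :=
  | ExecSkip s :
      exec Skip s s 1
  | ExecNSet s a i e :
      exec (NSet a i e) s
        (State (upd (nmem s) a (neval s i) (neval s e)) (rmem s))
        (ncost i + ncost e).+1
  | ExecRSet s a i e :
      exec (RSet a i e) s
        (State (nmem s) (upd (rmem s) a (neval s i) (reval s e)))
        (ncost i + rcost e).+1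
  | ExecSeq s1 s2 s3 c1 c2 t1 t2 :
      exec c1 s1 s2 t1 -> exec c2 s2 s3 t2 ->
      exec (Seq c1 c2) s1 s3 (t1 + t2)
  | ExecIf s s' b c1 c2 t :
      exec (if beval s b then c1 else c2) s s' t ->
      exec (If b c1 c2) s s' (bcost b + t).+1
  | ExecWhileFalse s b c :
      ~~ beval s b ->
      exec (While b c) s s (bcost b).+1
  | ExecWhileTrue s1 s2 s3 b c t1 t2 :
      beval s1 b -> exec c s1 s2 t1 -> exec (While b c) s2 s3 t2 ->
      exec (While b c) s1 s3 (bcost b + t1 + t2).+1.

Definition array_of (T : Type) (k : nat) (x0 : T) (f : 'I_k -> T) (i : nat) :
    T :=
  if insub i is Some j then f j else x0.

(** The tree is given by its edge list; unused cells are 0. *)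
Definition input_state (n m : nat) (I : instance R 'I_n 'I_m) : state :=
  State
    (fun a => match a with
       | 0 => nth 0%N [:: n; m; val (leaf_a I); val (leaf_b I)]
       | 1 => array_of 0%N (fun e => val (ends I e).1)
       | 2 => array_of 0%N (fun e => val (ends I e).2)
       | _ => fun=> 0%N
       end%N)
    (fun a => match a with
       | 0 => array_of 0%R (weight I)
       | 1 => array_of 0%R (len I)
       | 2 => array_of 0%R (bound I)
       | 3 => array_of 0%R (ucost I)
       | _ => fun=> 0%R
       end%N).

Definition out_flag (s : state) : nat := nmem s 3 0.

Definition out_sol (m : nat) (s : state) : 'I_m -> R := fun e => rmem s 4 e.

(** Flag 1 announces an optimal solution, flag 0 reports infeasibility. *)
Definition correct_output (n m : nat) (I : instance R 'I_n 'I_m)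
    (cost : ('I_m -> R) -> R) (s : state) : Prop :=
  (out_flag s = 1%N /\ optimal I cost (out_sol (m := m) s)) \/
  (out_flag s = 0%N /\ ~ exists x, feasible I x).

End Semantics.

(* Main.v *)
Require Import Defs.
From mathcomp Require Import all_boot all_order all_algebra.
From mathcomp Require Import zify lra.

Set Implicit Arguments.
Unset Strict Implicit.
Unset Printing Implicit Defensive.

Import Order.TTheory GRing.Theory Num.Theory.

(** Write [d] for the distance, [P u v] for the edges of the path from [u] to [v],
    and [S] for the set of vertices of positive weight.

    A diameter realizes all the eccentricities at once, so [a], [b] is a 2-maxian
    iff for each [v] in [S] one of [a], [b] is farthest from [v]
    ([is_2maxianE]).  The four-point condition of tree metrics turns this into
    three alternatives ([farthest_pair]): [a] is farthest from all of [S], or [b]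
    is, or [a], [b] is a diameter, that is, [a] is farthest from [b] and [b] from
    [a].  All of them are built from conditions of one kind, that a vertex [x] is
    farthest from a set of vertices.  Let the trunk be the intersection of the
    paths from [x] to that set.  The condition then says that, counting trunk
    edges negatively, every path that starts at [x] has length at most [0]
    ([farthest_signed]).  Trunk edges should be long and the others short, so
    among the modifications of cost at most [c] there is a best one: change as
    much as possible every edge of cost at most [c] whose permitted direction of
    change is the desired one ([test_root_complete]).  Hence it can be tested
    whether a solution of cost at most [c] exists; the test is monotone in [c],
    and the optimal cost is [0] or the cost of an edge.  The least such value that
    passes the test is the optimum, and the modification tested there is optimal
    ([test_optimal]); if none passes, the problem is infeasible.

    The program sorts these [n] values by merge sort ([sort_halts]) and searches
    among them by bisection ([search_halts]), with a linear-time test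
    ([test_halts]).  To test, the tree is hung at [x] by stripping leaves in the
    order of a queue ([strip_halts]).  This yields an order in which children
    precede parents, and on the way the vertices of the set in each branch are
    counted, so that an edge is in the trunk iff all of them are below it.
    Reading the queue backwards, one accumulates the signed lengths along the
    paths from [x] ([descend_halts]).  Altogether there are [O(log n)] merging
    passes and tests of linear time.

    The program logic consists of [halts c s T Q], which combines termination
    within [T] steps with a postcondition, and of the syntactic frame property
    [unchanged]. *)

(** * Paths in a tree *)

Section Paths.
Variables (V E : finType) (ends : E -> V * V).
Hypothesis tree : is_tree ends.
Local Notation joins := (joins ends).
Local Notation adj := (adj ends).
Local Notation simple_path := (simple_path ends).
Local Notation path_edges := (path_edges ends).
Local Notation P := (path_set ends).

Lemma joinsC e u v : joins e u v = joins e v u.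
Proof. by rewrite /Defs.joins orbC. Qed.

Lemma joins_ends e : joins e (ends e).1 (ends e).2.
Proof. by rewrite /Defs.joins -surjective_pairing eqxx. Qed.

Lemma joins_neq e u v : joins e u v -> u != v.
Proof.
by case/orP=> /eqP h; have := tree_loopless tree e; rewrite h // eq_sym.
Qed.

Lemma adjC : symmetric adj.
Proof. by move=> u v; apply: eq_existsb => e; rewrite joinsC. Qed.

Lemma joins_inj e u v u' v' :
  joins e u v -> joins e u' v' -> (u' \in [:: u; v]).
Proof.
by case/orP=> /eqP h; rewrite /Defs.joins h => /orP[] /eqP [-> ->];
  rewrite !inE eqxx ?orbT.
Qed.

Lemma simple_path_nil u p : simple_path u u p -> p = [::].
Proof.
case/and3P => _ /eqP; case/lastP: p => // p z.
by rewrite last_rcons => -> /=; rewrite mem_rcons inE eqxx.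
Qed.

(** Two simple paths that leave [u] through different neighbours and meet again
    bound a cycle, made of their parts before the first meeting point [z]. *)
Lemma simple_paths_diverge u p q :
  path adj u p -> path adj u q -> uniq (u :: p) -> uniq (u :: q) ->
  has [in q] p -> head u p = head u q.
Proof.
move=> + + + + meet; case: (split_find meet) => z p1 p2 zq np1.
case: (path.splitP zq) np1 => q1 q2 np1 pp pq up uq.
have cyc : ucycle adj (u :: rcons p1 z ++ rev q1).
  apply/andP; split.
    rewrite /= rcons_cat cat_path; move: pp; rewrite cat_path => /andP[-> _] /=.
    rewrite last_rcons -rev_cons; move: pq; rewrite cat_path => /andP[pq _].
    have := rev_path adj u (rcons q1 z).
    rewrite last_rcons belast_rcons => ->.
    by rewrite (eq_path (e' := adj)) // => ? ?; apply: adjC.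
  move: up uq; rewrite /= !mem_cat !cat_uniq !mem_rcons !inE mem_rev rev_uniq.
  rewrite !negb_or -!andbA => /and5P[-> -> _ -> _].
  case/and5P => _ -> _; rewrite rcons_uniq => /andP[zq1 ->] _ /=.
  rewrite andbT; apply/hasPn => w; rewrite mem_rev => wq1.
  rewrite /= mem_rcons inE negb_or; apply/andP; split.
    by apply: contraNneq zq1 => <-.
  apply: contra np1 => wp1; apply/hasP; exists w => //=.
  by rewrite mem_cat mem_rcons inE wq1 orbT.
move/(tree_acyclic tree): cyc.
rewrite /= size_cat size_rcons size_rev => size_cycle.
by case: p1 q1 size_cycle {pp pq up uq zq meet np1} => [|? ?] [|? ?].
Qed.

Lemma simple_path_unique u v p q :
  simple_path u v p -> simple_path u v q -> p = q.
Proof.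
elim: p u q => [|x p IHp] u [|y q] //.
- by case/and3P => _ /eqP /= -> _ /simple_path_nil.
- by move=> hp; case/and3P => _ /eqP /= h _; move: hp; rewrite h => /simple_path_nil.
move=> hp hq; case/and3P: (hp) => pp /eqP lp up; case/and3P: (hq) => pq /eqP lq uq.
have /= xy: head u (x :: p) = head u (y :: q).
  apply: simple_paths_diverge => //; apply/hasP; exists v.
    by rewrite -lp /= mem_last.
  by rewrite -lq /= mem_last.
rewrite -xy in hq *; congr cons; apply: (IHp x); move: hp hq;
  rewrite /Defs.simple_path /=.
  by case/and3P=> /andP[_ ->] -> /andP[_ ->].
by move=> _; case/and3P=> /andP[_ ->] -> /andP[_ ->].
Qed.

Lemma simple_path_exists u v : exists p, simple_path u v p.
Proof.
have /connectP[p pp ->] := tree_connected tree u v.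
case/shortenP: pp => p' pp' up' _; exists p'.
by rewrite /Defs.simple_path pp' up' eqxx.
Qed.

Lemma simple_path_size u v p : simple_path u v p -> (size p <= #|V|)%N.
Proof.
case/and3P=> _ _ up; have := max_card [in u :: p].
by move: (card_uniqP up) => /= -> /ltnW.
Qed.

Lemma path_setE u v p : simple_path u v p -> P u v = path_edges u p.
Proof.
move=> hp; apply/setP => e; rewrite inE; apply/existsP/idP.
  by case=> q /andP[hq]; rewrite (simple_path_unique hq hp).
move=> he; have sz := simple_path_size hp.
by exists (Bseq sz); rewrite hp he.
Qed.

Lemma path_edges_nil u : path_edges u [::] = set0.
Proof. by apply/setP => e; rewrite !inE. Qed.

Lemma path_edges_cons e u v p : joins e u v ->
  path_edges u (v :: p) = e |: path_edges v p.
Proof.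
move=> he; apply/setP => f; rewrite !inE /=; congr orb.
apply/idP/eqP => [hf|->] //; exact: (tree_no_parallel tree hf he).
Qed.

Lemma mem_path_edges e u p : e \in path_edges u p ->
  (ends e).1 \in u :: p /\ (ends e).2 \in u :: p.
Proof.
rewrite inE; elim: p u => //= v p IHp u /orP[|/IHp [h1 h2]]; last first.
  by rewrite in_cons h1 orbT in_cons h2 orbT.
by case/orP=> /eqP -> /=; rewrite !inE !eqxx !orbT.
Qed.

Lemma path_edges_rcons e u p v : joins e (last u p) v ->
  path_edges u (rcons p v) = e |: path_edges u p.
Proof.
elim: p u => [|x p IHp] u /= he.
  by rewrite (path_edges_cons _ he).
have [f hf|] := pickP (fun f => joins f u x).
  by rewrite !(path_edges_cons _ hf) (IHp _ he) setUCA.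
move=> nf; apply/setP => f; have := IHp x he; move/setP/(_ f).
by rewrite !inE /= nf.
Qed.

Lemma path_set_xx x : P x x = set0.
Proof.
by rewrite (@path_setE x x [::]) ?path_edges_nil // /Defs.simple_path /= eqxx.
Qed.

(** Crossing one edge changes the path from the root by exactly that edge: the
    edge is either appended to the path or it was its last step. *)
Lemma path_set_step x e u v : joins e u v ->
  forall f, (f \in P x v) = (f \in P x u) (+) (f == e).
Proof.
have [p hp] := simple_path_exists x u.
move=> he; have := hp; case/and3P => pp /eqP lp up.
have uv := joins_neq he.
have [vp|vp] := boolP (v \in x :: p).
  case/splitPl: vp hp pp lp up => p1 p2 lp1 hp pp lp up.
  have hp1 : simple_path x v p1.
    rewrite /Defs.simple_path lp1 eqxx; move: pp; rewrite cat_path => /andP[-> _].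
    by move: up; rewrite -cat_cons cat_uniq => /andP[->].
  have hq : simple_path x u (rcons p1 u).
    rewrite /Defs.simple_path last_rcons eqxx rcons_path lp1.
    case/and3P: hp1 => -> _ up1; rewrite -rcons_cons rcons_uniq up1 !andbT.
    apply/andP; split; first by apply/existsP; exists e; rewrite joinsC.
    case: p2 lp up {hp pp} => [|y p2] lp up.
      by move: lp; rewrite cats0 lp1 => vu; rewrite vu eqxx in uv.
    move: up; rewrite -cat_cons cat_uniq => /and3P[_ /hasPn + _]; apply.
    by rewrite -lp last_cat /= mem_last.
  have ne : e \notin P x v.
    rewrite (path_setE hp1); apply/negP => /mem_path_edges [h1 h2].
    case/and3P: hq => _ _; rewrite -rcons_cons rcons_uniq => /andP[/negP + _]; apply.
    by case/orP: he => /eqP he; rewrite he /= in h1 h2.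
  rewrite (path_setE hq) (path_setE hp1) (@path_edges_rcons e) ?lp1 1?joinsC //.
  rewrite -(path_setE hp1); move=> f.
  rewrite in_setU1; case: (eqVneq f e) => [->|] /=; last by rewrite addbF.
  by rewrite (negPf ne).
have hq : simple_path x v (rcons p v).
  rewrite /Defs.simple_path last_rcons eqxx rcons_path pp lp.
  rewrite -rcons_cons rcons_uniq up vp !andbT /=.
  by apply/existsP; exists e.
have ne : e \notin P x u.
  rewrite (path_setE hp); apply/negP => /mem_path_edges [h1 h2].
  by case/negP: vp; case/orP: he => /eqP he; rewrite he /= in h1 h2.
rewrite (path_setE hq) (@path_edges_rcons e) ?lp // -(path_setE hp) => f.
rewrite in_setU1; case: (eqVneq f e) => [->|] /=; last by rewrite addbF.
by rewrite (negPf ne).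
Qed.

(** Each step of the path from [u] to [v] toggles its edge in the path from [x],
    and no edge is used twice. *)
Lemma path_set_xor x u v f : (f \in P u v) = (f \in P x u) (+) (f \in P x v).
Proof.
have [p hp] := simple_path_exists u v; rewrite (path_setE hp).
elim: p u f hp => [|y p IHp] u f.
  by case/and3P=> _ /eqP /= <- _; rewrite addbb inE.
case/and3P => /= /andP[/existsP[e he] pp] lp /andP[nu up].
rewrite (path_edges_cons _ he) in_setU1 IHp; last first.
  by rewrite /Defs.simple_path /= pp lp up.
rewrite (path_set_step x he).
have hy : simple_path y v p by rewrite /Defs.simple_path /= pp lp up.
case: (eqVneq f e) => [->|] /=; last by rewrite addbF.
have : e \notin path_edges y p.
  apply/negP => /mem_path_edges [h1 h2].
  by case/negP: nu; case/orP: he => /eqP he; rewrite he in h1 h2.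
rewrite (IHp y e hy); rewrite (path_set_step x he).
by rewrite eqxx addbT; case: (e \in P x u); case: (e \in P x v).
Qed.

Lemma path_setC u v : P u v = P v u.
Proof.
by apply/setP => f; rewrite (path_set_xor u v u) path_set_xx [in X in _ (+) X]in_set0 addbF.
Qed.

(** The tree hung at [x].  Since [P x v] is [P x (par v)] and one new edge, its
    cardinal is the depth of [v], the measure for inductions on the tree. *)
Record rooted (x : V) (par : V -> V) (pe : V -> E) : Prop := Rooted {
  rooted_joins : forall v, v != x -> joins (pe v) v (par v);
  rooted_path : forall v, v != x -> P x v = pe v |: P x (par v);
  rooted_fresh : forall v, v != x -> pe v \notin P x (par v)
}.

Lemma rooted_exists (x : V) (e0 : E) : exists par pe, rooted x par pe.
Proof.
have step v : exists ue : V * E, v != x ->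
    [/\ joins ue.2 v ue.1, P x v = ue.2 |: P x ue.1 & ue.2 \notin P x ue.1].
  have [->|vx] := eqVneq v x; first by exists (x, e0).
  have [p hp] := simple_path_exists x v; have := hp.
  case/lastP: p hp => [|p u] hp; case/and3P.
    by move=> _ /= /eqP xv; rewrite xv eqxx in vx.
  rewrite rcons_path last_rcons -rcons_cons rcons_uniq => /andP[pp].
  case/existsP => e he /eqP uv /andP[up uniqp]; rewrite {u}uv in hp he up *.
  have hp' : simple_path x (last x p) p by rewrite /Defs.simple_path pp eqxx.
  exists (last x p, e) => _ /=; rewrite (path_setE hp) (path_setE hp').
  rewrite joinsC he (path_edges_rcons he); split=> //.
  apply/negP => /mem_path_edges [h1 h2]; case/negP: up.
  by case/orP: he => /eqP he; rewrite he in h1 h2.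
have [f hf] := fin_all_exists step.
exists (fun v => (f v).1), (fun v => (f v).2).
by split=> v /hf[].
Qed.

Section Rooted.
Variables (x : V) (par : V -> V) (pe : V -> E).
Hypothesis root : rooted x par pe.

Lemma card_path_par v : v != x -> #|P x v| = #|P x (par v)|.+1.
Proof. by move=> vx; rewrite (rooted_path root vx) cardsU1 (rooted_fresh root vx). Qed.

Lemma rooted_ind (K : V -> Prop) :
  K x -> (forall v, v != x -> K (par v) -> K v) -> forall v, K v.
Proof.
move=> K0 KS v; have [k] := ubnP #|P x v|; elim: k v => // k IHk v.
have [->//|vx] := eqVneq v x.
by rewrite (card_path_par vx) ltnS => hk; apply: KS => //; apply: IHk.
Qed.

Lemma pe_inj v w : v != x -> w != x -> pe v = pe w -> v = w.
Proof.
move=> vx wx vw; have hv := rooted_joins root vx; have hw := rooted_joins root wx.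
apply/eqP; have := joins_inj hv (_ : joins (pe v) w (par w)); rewrite vw => /(_ hw).
rewrite !inE => /orP[/eqP ->//|/eqP wv]; case/negP: (rooted_fresh root vx).
by rewrite -wv vw (rooted_path root wx) setU11.
Qed.

(** The path from [x] to one of the two ends of [e] contains [e], and the edges
    of such a path are parent edges. *)
Lemma pe_surj e : exists2 v, v != x & pe v = e.
Proof.
suff below v : e \in P x v -> exists2 v, v != x & pe v = e.
  have := path_set_step x (joins_ends e) e; rewrite eqxx addbT => h.
  have [|] := boolP (e \in P x (ends e).1); first exact: below.
  by rewrite -h; apply: below.
elim/rooted_ind: v => [|v vx IHv]; first by rewrite path_set_xx in_set0.
by rewrite (rooted_path root vx) in_setU1 => /orP[/eqP ->|//]; exists v.
Qed.

(** The edge [pe u] can only be crossed downwards at [u], so a path from [x] that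
    uses it starts with the path to [u]. *)
Lemma path_set_desc u w : u != x -> pe u \in P x w -> P x u \subset P x w.
Proof.
move=> ux; elim/rooted_ind: w => [|w wx IHw]; first by rewrite path_set_xx in_set0.
rewrite {1}(rooted_path root wx) in_setU1 => /orP[/eqP h|/IHw h].
  by rewrite (pe_inj ux wx h).
by rewrite (rooted_path root wx) (subset_trans h) // subsetUr.
Qed.

(** Of two edges on a path from [x], the one nearer to [x] must be crossed to
    reach the other. *)
Lemma path_set_laminar u e f : e \in P x u -> f \in P x u ->
  (forall w, e \in P x w -> f \in P x w) \/ (forall w, f \in P x w -> e \in P x w).
Proof.
elim/rooted_ind: u => [|u ux IHu]; first by rewrite path_set_xx in_set0.
have upper g : g \in P x (par u) -> forall w, pe u \in P x w -> g \in P x w.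
  move=> gu w /(path_set_desc ux) /subsetP; apply.
  by rewrite (rooted_path root ux) in_setU1 gu orbT.
rewrite (rooted_path root ux) !in_setU1.
case/orP=> [/eqP ->|eu]; case/orP=> [/eqP ->|fu]; by [left|right; apply: upper|left; apply: upper|apply: IHu].
Qed.

End Rooted.

(** The paths from [x] branch like a tree: from the path to [u], the paths to
    [v] and [w] each keep an initial segment. *)
Lemma path_set_nested x u v w :
  P x u :&: P x v \subset P x w \/ P x u :&: P x w \subset P x v.
Proof.
case: (boolP (P x u :&: P x v \subset P x w)) => [|/subsetPn [e]]; first by left.
rewrite in_setI => /andP[eu ev] ew; right; apply/subsetP => f.
rewrite in_setI => /andP[fu fw].
have [par [pe root]] := rooted_exists x e.
case: (path_set_laminar root eu fu) => [->//|/(_ w fw)].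
by rewrite (negPf ew).
Qed.

End Paths.

(** * Tree metrics and farthest vertices *)

Section Metric.
Local Open Scope ring_scope.
Variables (V E : finType) (ends : E -> V * V).
Hypothesis tree : is_tree ends.
Variables (R : realFieldType) (l : E -> R).
Hypothesis l_ge0 : forall e, 0 <= l e.
Local Notation P := (path_set ends).
Local Notation dist := (dist ends l).

Lemma sum_subset (A B : {set E}) :
  A \subset B -> \sum_(e in A) l e <= \sum_(e in B) l e.
Proof.
move=> AB; rewrite [leRHS](big_setID A) /= (setIidPr AB) lerDl.
by apply: sumr_ge0.
Qed.

Lemma distE u v : dist u v = \sum_(e in P u v) l e.
Proof.
have [p hp] := simple_path_exists tree u v; have sz := simple_path_size hp.
apply/eqP; rewrite eq_le; apply/andP; split.
  by rewrite (path_setE tree hp); apply: (bigmin_le_cond _ (j := Bseq sz)).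
apply: le_bigmin => [|q hq]; last by rewrite -(path_setE tree hq).
by rewrite [leRHS](bigID [in P u v]) /= lerDl sumr_ge0.
Qed.

Lemma distC u v : dist u v = dist v u.
Proof. by rewrite !distE (path_setC tree). Qed.

Lemma dist_refl u : dist u u = 0.
Proof. by rewrite distE (path_set_xx tree) big_set0. Qed.

Lemma dist_ge0 u v : 0 <= dist u v.
Proof. by rewrite distE; apply: sumr_ge0. Qed.

(** The sum is the length that the paths from [x] to [u] and to [v] have in
    common, and that the path from [u] to [v] avoids. *)
Lemma dist_meet x u v : dist u v =
  dist x u + dist x v - 2 * \sum_(e in P x u :&: P x v) l e.
Proof.
have mk A : \sum_(e in A) l e = \sum_e (if e \in A then l e else 0).
  by rewrite -big_mkcond.
rewrite !distE !mk mulr_sumr -big_split -sumrB /=.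
apply: eq_bigr => e _.
by rewrite in_setI (path_set_xor tree x); case: (_ \in _); case: (_ \in _) => /=; lra.
Qed.

(** By [dist_meet], the claim compares the lengths that the paths from [x] to
    [y], [z] and [w] share pairwise; by nesting, the two smallest of these
    lengths agree. *)
Lemma four_point x y z w :
  dist x y + dist z w <= Num.max (dist x z + dist y w) (dist x w + dist y z).
Proof.
rewrite (dist_meet x z w) (dist_meet x y w) (dist_meet x y z) le_max.
have [sub|sub] := path_set_nested tree x y z w.
  have := sum_subset (_ : P x y :&: P x z \subset P x z :&: P x w).
  rewrite subsetI subsetIr => /(_ sub) h; apply/orP; right; lra.
have := sum_subset (_ : P x y :&: P x w \subset P x z :&: P x w).
by rewrite subsetI subsetIr sub => /(_ isT) h; apply/orP; left; lra.
Qed.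

Definition farthest_from (S : {set V}) (x : V) : Prop :=
  forall v u, v \in S -> dist v u <= dist v x.

(** The strict inequalities decide the four-point condition of [a], [b], [v], [v']:
    [dist v v' + dist a b = dist v a + dist v' b].  A vertex farther from [a] than
    [b] would therefore be too far from [v] or [v']. *)
Lemma opposite_farthest a b v v' :
  (forall u, dist v u <= dist v a) -> dist v b < dist v a ->
  (forall u, dist v' u <= dist v' b) -> dist v' a < dist v' b ->
  forall u, dist a u <= dist a b.
Proof.
move=> va ltv v'b ltv' u; have := va u; have := v'b u; have := va v'; have := v'b v.
have := four_point a v b v'; have := four_point v v' a b.
have := four_point a b v v'; have := four_point a u v v'.
rewrite !le_max !(distC a v) !(distC a v') !(distC b v) !(distC b v').
rewrite !(distC u v) !(distC u v') !(distC v' v).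
move=> /orP[] h1 /orP[] h2 /orP[] h3 /orP[] h4; lra.
Qed.

(** In the four-point condition for [v], [u], [a], [b] the two pairs on the right
    are bounded by [dist a b] plus a distance from [v]. *)
Lemma diameter_farthest a b :
  farthest_from [set b] a -> farthest_from [set a] b ->
  forall v u, dist v u <= Num.max (dist v a) (dist v b).
Proof.
move=> hb ha v u; have {}hb := hb b u (set11 _); have {}ha := ha a u (set11 _).
have := four_point v u a b; rewrite !le_max (distC u b) (distC u a) (distC b a) in hb *.
by move=> /orP[] h; apply/orP; [left|right]; lra.
Qed.

(** If neither [a] nor [b] is farthest from all of [S], then [S] contains a
    vertex for which only [b] is farthest and one for which only [a] is, and
    [opposite_farthest] makes [a], [b] a diameter.  The point of the three cases
    is that none of them mentions a maximum: each can be pursued by moving every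
    edge length in one fixed direction. *)
Lemma farthest_pair (S : {set V}) a b :
  (forall v u, v \in S -> dist v u <= Num.max (dist v a) (dist v b)) <->
  [\/ farthest_from S a, farthest_from S b
    | farthest_from [set b] a /\ farthest_from [set a] b].
Proof.
split=> [hS|]; last first.
  case=> [h|h|[h1 h2]] v u vS.
  - by rewrite le_max h.
  - by rewrite le_max h ?orbT.
  - exact: diameter_farthest.
have [/forall_inP ha|/forall_inPn [v vS nva]] :=
    boolP [forall v in S, [forall u, dist v u <= dist v a]].
  by constructor 1 => v u /ha /forallP.
have [/forall_inP hb|/forall_inPn [v' v'S nvb]] :=
    boolP [forall v in S, [forall u, dist v u <= dist v b]].
  by constructor 2 => w u /hb /forallP.
have side c d w : w \in S -> ~~ [forall u, dist w u <= dist w c] ->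
    (forall u, dist w u <= Num.max (dist w c) (dist w d)) ->
    (forall u, dist w u <= dist w d) /\ dist w c < dist w d.
  move=> wS /forallPn[u nu] hu; have := hu u.
  rewrite le_max (negPf nu) /= => ud; rewrite -ltNge in nu.
  have cd := lt_le_trans nu ud; split=> // u'.
  by have := hu u'; rewrite le_max => /orP[h|//]; apply: le_trans h (ltW cd).
have [vb vab] := side a b v vS nva (fun u => hS v u vS).
have [|v'a v'ab] := side b a v' v'S nvb.
  by move=> u; rewrite maxC; apply: hS.
constructor 3; split=> w u; rewrite in_set1 => /eqP ->.
  exact: opposite_farthest vb vab v'a v'ab u.
exact: opposite_farthest v'a v'ab vb vab u.
Qed.

(** For empty [S] these are all the edges, so that [farthest_signed] covers that
    case too. *)
Definition trunk (x : V) (S : {set V}) : {set E} :=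
  [set e | [forall v in S, e \in P x v]].

Lemma trunkP x (S : {set V}) e :
  reflect (forall v, v \in S -> e \in P x v) (e \in trunk x S).
Proof. by rewrite /trunk in_set; apply: forall_inP. Qed.

Definition signed_len (x : V) (S : {set V}) (e : E) : R :=
  if e \in trunk x S then - l e else l e.

(** For [v] in [S], [dist v u <= dist v x] says that the part of [P x u] off
    [P x v] is at most as long as the part on it; among these conditions the
    strongest is for the [v] whose path shares least with [P x u], and what
    they share is then the trunk. *)
Lemma farthest_signed (S : {set V}) x :
  farthest_from S x <-> forall u, \sum_(e in P x u) signed_len x S e <= 0.
Proof.
have sumE u (A : {set E}) : \sum_(e in P x u) (if e \in A then - l e else l e)
    = dist x u - 2 * \sum_(e in P x u :&: A) l e.
  rewrite distE (bigID [in A]) [X in X - _](bigID [in A]) /=.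
  rewrite (eq_bigr (fun e => - l e)); last by move=> e /andP[_ ->].
  rewrite [X in _ + X](eq_bigr l); last by move=> e /andP[_ /negPf ->].
  have -> : \sum_(e in P x u :&: A) l e = \sum_(e in P x u | e \in A) l e.
    by apply: eq_bigl => e; rewrite in_setI.
  by rewrite sumrN; lra.
have farE v u : (dist v u <= dist v x) =
    (dist x u - 2 * \sum_(e in P x u :&: P x v) l e <= 0).
  by rewrite (dist_meet x v u) (distC v x) (setIC (P x v)); apply/idP/idP => h; lra.
split=> h u.
  have [->|/set0Pn [v0 v0S]] := eqVneq S set0.
    rewrite -oppr_ge0 -sumrN; apply: sumr_ge0 => e _; rewrite /signed_len.
    by case: trunkP => [_|[]]; rewrite ?opprK // => v; rewrite in_set0.
  case: (arg_minnP (fun v => #|P x u :&: P x v|) v0S) => v vS vmin.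
  rewrite sumE; suff -> : P x u :&: trunk x S = P x u :&: P x v by rewrite -farE h.
  apply/eqP; rewrite eqEsubset !subsetI !subsetIl /=; apply/andP; split.
    by apply/subsetP => e; rewrite in_setI => /andP[_ /trunkP]; apply.
  apply/subsetP => e he; apply/trunkP => w wS.
  suff : P x u :&: P x v \subset P x w by move/subsetP; apply.
  have [//|sub] := path_set_nested tree x u v w.
  have /eqP <- : P x u :&: P x w == P x u :&: P x v.
    by rewrite eqEcard subsetI subsetIl sub vmin.
  exact: subsetIr.
move=> v vS; rewrite farE; apply: le_trans (h v); rewrite sumE.
rewrite lerD2l lerN2 ler_pM2l ?ltr0n //; apply: sum_subset; apply: setIS.
by apply/subsetP => e /trunkP; apply.
Qed.

End Metric.

(** * Optimal pairs of points *)

Section Maxian.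
Local Open Scope ring_scope.
Variables (V E : finType) (ends : E -> V * V).
Hypothesis tree : is_tree ends.
Variables (R : realFieldType) (l : E -> R).
Hypothesis l_ge0 : forall e, 0 <= l e.
Local Notation P := (path_set ends).
Local Notation dist := (dist ends l).

Lemma dist_step e v : dist v (ends e).2 = dist v (ends e).1 + l e \/
  dist v (ends e).1 = dist v (ends e).2 + l e.
Proof.
rewrite !(distE tree l_ge0); have h := path_set_step tree v (joins_ends ends e).
have [e1|e1] := boolP (e \in P v (ends e).1); [right|left].
  rewrite (big_setD1 e e1) /= addrC; congr (_ + _); apply: eq_bigl => f.
  by rewrite in_setD1 h; case: eqP => [->|]; rewrite ?e1 ?addbF.
have e2 : e \in P v (ends e).2 by rewrite h eqxx (negPf e1).
rewrite (big_setD1 e e2) /= addrC; congr (_ + _); apply: eq_bigl => f.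
by rewrite in_setD1 h; case: eqP => [->|]; rewrite ?(negPf e1) ?addbF.
Qed.

(** On an edge the distance from [v] is largest at an end. *)
Lemma pdist_le_vertex v x : is_point l x -> exists u, pdist ends l v x <= dist v u.
Proof.
case: x => [u|e t] /=; first by exists u.
case/andP => t0 tl; case: (dist_step e v) => h.
  by exists (ends e).2; rewrite ge_min; apply/orP; left; lra.
by exists (ends e).1; rewrite ge_min; apply/orP; right; lra.
Qed.

Lemma diameter_exists (a b : V) : a != b ->
  exists y1 y2 : V, y1 != y2 /\
    forall v u, dist v u <= Num.max (dist v y1) (dist v y2).
Proof.
move=> ab; pose d (p : V * V) := dist p.1 p.2.
case: (@Order.TotalTheory.arg_maxP _ _ _ (a, b) (fun p : V * V => p.1 != p.2) d ab).
move=> [y1 y2] /= y12 ymax; exists y1, y2; split=> //.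
have max v u : dist v u <= dist y1 y2.
  have [->|vu] := eqVneq v u; last exact: (ymax (v, u)).
  by rewrite (dist_refl tree l_ge0) (dist_ge0 tree l_ge0).
apply: (diameter_farthest tree l_ge0) => v u; rewrite in_set1 => /eqP -> //.
by rewrite (distC tree l_ge0 y2 y1).
Qed.

(** Among all pairs of points a diameter maximizes every term of the objective
    at once; so a pair is optimal iff it does the same for the terms of
    positive weight. *)
Lemma is_2maxianE (w : V -> R) a b : (forall v, 0 <= w v) -> a != b ->
  is_2maxian ends l w (Vertex E R a) (Vertex E R b) <->
  forall v u, v \in [set v | 0 < w v] ->
    dist v u <= Num.max (dist v a) (dist v b).
Proof.
move=> w0 ab; split=> [[_ _ _ opt] v u|far].
  rewrite inE => wv; have [y1 [y2 [y12 ymax]]] := diameter_exists ab.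
  have yle v' : w v' * Num.max (dist v' a) (dist v' b) <=
                w v' * Num.max (dist v' y1) (dist v' y2).
    by rewrite ler_wpM2l // ge_max !ymax.
  have ne : Vertex E R y1 <> Vertex E R y2 by case => /eqP; apply/negP.
  have := opt (Vertex E R y1) (Vertex E R y2) I I ne; rewrite /maxian_value /= => le.
  have : \sum_v (w v * Num.max (dist v y1) (dist v y2) -
                      w v * Num.max (dist v a) (dist v b)) == 0.
    by rewrite sumrB subr_eq0 eq_le le ler_sum.
  rewrite psumr_eq0 => [/allP/(_ v)|v' _]; last by rewrite subr_ge0.
  rewrite mem_index_enum -mulrBr mulf_eq0 gt_eqF //= => /(_ isT).
  by rewrite subr_eq0 => /eqP <-.
split=> // [[/eqP]|y1 y2 hy1 hy2 _]; first exact/negP.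
apply: ler_sum => v _; have [wv|] := boolP (0 < w v); last first.
  by rewrite lt_def w0 andbT negbK => /eqP ->; rewrite !mul0r.
rewrite ler_wpM2l //= ge_max; have [u1 h1] := pdist_le_vertex v hy1.
have [u2 h2] := pdist_le_vertex v hy2.
by rewrite (le_trans h1) ?(le_trans h2) ?far // inE.
Qed.

End Maxian.

(** * From the inverse problem to a threshold test *)

Section Instance.
Local Open Scope ring_scope.
Variables (R : realFieldType) (V E : finType) (I : instance R V E).
Hypothesis valI : valid I.
Local Notation a := (leaf_a I).
Local Notation b := (leaf_b I).
Local Notation P := (path_set (ends I)).
Let tree := valid_tree valI.

Definition heavy : {set V} := [set v | 0 < weight I v].

Definition good (l : E -> R) (x : V) (S : {set V}) : bool :=
  [forall u, \sum_(e in P x u) signed_len (ends I) l x S e <= 0].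

Lemma goodP (l : E -> R) x S : (forall e, 0 <= l e) ->
  reflect (farthest_from (ends I) l S x) (good l x S).
Proof.
move=> l0; apply: (iffP forallP) => h; first exact/(farthest_signed tree l0).
exact/(farthest_signed tree l0).
Qed.

Lemma eq_good (l l' : E -> R) x S : l =1 l' -> good l x S = good l' x S.
Proof.
move=> ll; apply: eq_forallb => u; congr (_ <= _).
by apply: eq_bigr => e _; rewrite /signed_len !ll.
Qed.

Definition good_pair (l : E -> R) : bool :=
  [|| good l a heavy, good l b heavy
    | good l a [set b] && good l b [set a]].

Lemma good_pairE (x : E -> R) : (forall e, 0 <= new_len I x e) ->
  good_pair (new_len I x) <->
  is_2maxian (ends I) (new_len I x) (weight I) (Vertex E R a) (Vertex E R b).
Proof.
move=> l0; rewrite (is_2maxianE tree l0 (valid_weight valI) (valid_leaf_neq valI)).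
rewrite (farthest_pair tree l0) /good_pair; split.
  case/or3P => [/(goodP _ _ l0) h|/(goodP _ _ l0) h|/andP[]]; first by constructor 1.
    by constructor 2.
  by move=> /(goodP _ _ l0) h1 /(goodP _ _ l0) h2; constructor 3.
case=> [/(goodP _ _ l0) ->//|/(goodP _ _ l0) ->|[]]; first by rewrite orbT.
by move=> /(goodP _ _ l0) -> /(goodP _ _ l0) ->; rewrite !orbT.
Qed.

(** Off [P a b] an edge cannot lose more than its length. *)
Definition cap (e : E) : R :=
  if e \in P a b then bound I e else Num.min (bound I e) (len I e).

(** To make [x] farthest from all of [S], trunk edges should be long and all
    other edges short.  An edge is therefore modified, and then as much as
    possible, when it can change in the desired direction: the edges of
    [P a b] can only grow, the others only shrink. *)
Definition best_change (c : R) (x : V) (S : {set V}) (e : E) : R :=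
  if (ucost I e <= c) && ((e \in trunk (ends I) x S) == (e \in P a b))
  then cap e else 0.

Lemma cap_ge0 e : 0 <= cap e.
Proof.
by rewrite /cap; case: ifP => _; rewrite ?le_min ?(valid_bound valI) ?(valid_len valI).
Qed.

Lemma best_change_bound c x S e : 0 <= best_change c x S e <= bound I e.
Proof.
rewrite /best_change; case: ifP => _; last by rewrite lexx (valid_bound valI).
by rewrite cap_ge0 /cap; case: ifP => //=; rewrite ge_min lexx.
Qed.

Lemma new_len_best_ge0 c x S e : 0 <= new_len I (best_change c x S) e.
Proof.
have := valid_len valI e; have /andP[h1 h2] := best_change_bound c x S e.
rewrite /new_len; case: ifP => [_|eab] l0; first by rewrite addr_ge0.
rewrite subr_ge0 /best_change /cap; case: ifP => // _.
by rewrite eab ge_min lexx orbT.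
Qed.

Definition test_root c x S := good (new_len I (best_change c x S)) x S.

(** Compared with any admissible [y] of cost at most [c], [best_change] moves each
    signed length at least as far down. *)
Lemma test_root_complete c (y : E -> R) x S :
  (forall e, 0 <= y e <= bound I e) -> (forall e, 0 <= new_len I y e) ->
  (forall e, y e != 0 -> ucost I e <= c) ->
  good (new_len I y) x S -> test_root c x S.
Proof.
move=> yb yl yc /forallP gy; apply/forallP => u; apply: le_trans (gy u).
apply: ler_sum => e _; have /andP[ye0 yeb] := yb e; have := yl e.
rewrite /signed_len /new_len /best_change /cap.
have [ec|ec] := boolP (ucost I e <= c); last first.
  have -> : y e = 0 by apply/eqP; apply: contraNT ec; apply: yc.
  by [].
by case: (e \in trunk _ _ _); case: (e \in P a b) => /= yle;
  rewrite ?addr0 ?subr0 ?lerN2 ?lerD2l ?lerN2 ?le_min ?yeb //=; lra.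
Qed.

(** One test for each case of [farthest_pair], each with the modification that
    suits that case best.  The last two share their modification, by
    [trunk_pair]. *)
Definition test c : bool :=
  [|| test_root c a heavy, test_root c b heavy
    | test_root c a [set b] && test_root c b [set a]].

Lemma test_complete c y : feasible I y ->
  (forall e, y e != 0 -> ucost I e <= c) -> test c.
Proof.
case=> yb yl /(good_pairE yl) gy yc; have complete := test_root_complete yb yl yc.
rewrite /test; case/or3P: gy => [/complete ->//|/complete ->|]; first by rewrite orbT.
by case/andP => /complete h1 /complete h2; apply/or3P; constructor 3; apply/andP.
Qed.

Lemma trunk_pair : trunk (ends I) a [set b] = trunk (ends I) b [set a].
Proof.
apply/setP => e; apply/trunkP/trunkP => h v; rewrite in_set1 => /eqP ->.
  by rewrite (path_setC tree) h ?set11.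
by rewrite (path_setC tree) h ?set11.
Qed.

Definition solution c : E -> R :=
  if test_root c a heavy then best_change c a heavy
  else if test_root c b heavy then best_change c b heavy
  else best_change c b [set a].

Lemma test_sound c X : test c -> X =1 solution c -> feasible I X.
Proof.
move=> tc XE; have best : exists x S, solution c = best_change c x S.
  by rewrite /solution; do 2?case: ifP => _; do 2!eexists.
case: best => x [S sol].
have lenE : new_len I X =1 new_len I (solution c) by move=> e; rewrite /new_len XE.
have l0 e : 0 <= new_len I X e by rewrite lenE sol new_len_best_ge0.
split=> // [e|]; first by rewrite XE sol best_change_bound.
apply/(good_pairE l0); rewrite /good_pair !(eq_good _ _ lenE) /solution.
case: ifP => [|na]; first by rewrite /test_root => ->.
case: ifP => [|nb]; first by rewrite /test_root => ->; rewrite orbT.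
move: tc; rewrite /test na nb /= => /andP[h1 h2]; apply/or3P; constructor 3.
move: h2; rewrite /test_root => ->; rewrite andbT.
rewrite -(eq_good (l := new_len I (best_change c a [set b]))) // => e.
by rewrite /new_len /best_change trunk_pair.
Qed.

Lemma solution_cost c e : solution c e != 0 -> ucost I e <= c.
Proof.
have best y S : best_change c y S e != 0 -> ucost I e <= c.
  by rewrite /best_change; case: ifP => [/andP[]//|]; rewrite eqxx.
by rewrite /solution; do 2?case: ifP => _; apply: best.
Qed.

(** Passing the test at [c] amounts to the existence of a solution that only
    touches edges of cost at most [c]. *)
Lemma test_mono c c' : c <= c' -> test c -> test c'.
Proof.
move=> cc tc; apply: (test_complete (test_sound tc (frefl _))) => e.
by move/solution_cost => h; apply: le_trans h cc.
Qed.

Definition candidate c : Prop := c = 0 \/ exists e, c = ucost I e.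

Lemma bottleneck_candidate y : candidate (bottleneck_hamming I y).
Proof.
apply: big_ind => [|c c' hc hc'|e _]; first by left.
  by rewrite /Num.max; case: ifP.
by rewrite /hamming; case: ifP => _; rewrite ?mulr0 ?mulr1; [left|right; exists e].
Qed.

Lemma bottleneck_ge y e : y e != 0 -> ucost I e <= bottleneck_hamming I y.
Proof.
move=> ye; have := le_bigmax 0 (fun e => ucost I e * hamming (y e)) e.
by rewrite /hamming (negPf ye) mulr1.
Qed.

Lemma feasible_test y : feasible I y -> test (bottleneck_hamming I y).
Proof. by move=> fy; apply: (test_complete fy) => e; apply: bottleneck_ge. Qed.

(** The optimal value is a candidate that passes the test, and the solution for
    [c] costs at most [c]; so the least candidate that passes is optimal. *)
Lemma test_optimal c X : 0 <= c -> test c -> X =1 solution c ->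
  (forall c', candidate c' -> test c' -> c <= c') ->
  optimal I (bottleneck_hamming I) X.
Proof.
move=> c0 tc XE cmin; split; first exact: test_sound XE.
move=> y fy; apply: (@le_trans _ _ c); last first.
  by apply: cmin (bottleneck_candidate y) (feasible_test fy).
apply: bigmax_le => // e _; rewrite /hamming XE; case: eqP => [_|/eqP h].
  by rewrite mulr0.
by rewrite mulr1 (solution_cost h).
Qed.

Lemma test_infeasible : (forall c, candidate c -> ~~ test c) ->
  ~ exists y, feasible I y.
Proof.
move=> no [y fy]; have := no _ (bottleneck_candidate y).
by rewrite feasible_test.
Qed.

End Instance.

(** * A timed program logic *)

Notation "c1 ;; c2" := (Seq c1 c2) (at level 90, right associativity).

Definition nvar (a : nat) : nexp := NGet a (NConst 0).
Definition nassign (a : nat) (e : nexp) : cmd := NSet a (NConst 0) e.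
Definition rassign (a : nat) (e : rexp) : cmd := RSet a (NConst 0) e.
Definition BNLt (e1 e2 : nexp) : bexp := BNot (BNLe e2 e1).
Definition BNEq (e1 e2 : nexp) : bexp := BAnd (BNLe e1 e2) (BNLe e2 e1).
Definition BOr (b1 b2 : bexp) : bexp := BNot (BAnd (BNot b1) (BNot b2)).

Definition for_loop (i : nat) (bnd : nexp) (body : cmd) : cmd :=
  nassign i (NConst 0);;
  While (BNLt (nvar i) bnd)
    (body;; nassign i (NAdd (nvar i) (NConst 1))).

Fixpoint nwrites (c : cmd) : seq nat :=
  match c with
  | NSet a _ _ => [:: a]
  | Seq c1 c2 | If _ c1 c2 => nwrites c1 ++ nwrites c2
  | While _ c1 => nwrites c1
  | _ => [::]
  end.

Fixpoint rwrites (c : cmd) : seq nat :=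
  match c with
  | RSet a _ _ => [:: a]
  | Seq c1 c2 | If _ c1 c2 => rwrites c1 ++ rwrites c2
  | While _ c1 => rwrites c1
  | _ => [::]
  end.

Fixpoint loop_free (c : cmd) : bool :=
  match c with
  | While _ _ => false
  | Seq c1 c2 | If _ c1 c2 => loop_free c1 && loop_free c2
  | _ => true
  end.

(** Bounds the running time of a loop-free program; both branches of an [If] are
    charged. *)
Fixpoint time_bound (c : cmd) : nat :=
  match c with
  | Skip | While _ _ => 1
  | NSet _ i e => (ncost i + ncost e).+1
  | RSet _ i e => (ncost i + rcost e).+1
  | Seq c1 c2 => time_bound c1 + time_bound c2
  | If b c1 c2 => (bcost b + (time_bound c1 + time_bound c2)).+1
  end%N.

Section Logic.
Variable R : realFieldType.
Local Notation state := (state R).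
Implicit Types (s : state) (c : cmd) (Q : state -> Prop).

Definition setn s a i x := State (upd (nmem s) a i x) (rmem s).
Definition setr s a i x := State (nmem s) (upd (rmem s) a i x).

Fixpoint run (c : cmd) (s : state) : state :=
  match c with
  | Skip | While _ _ => s
  | NSet a i e => setn s a (neval s i) (neval s e)
  | RSet a i e => setr s a (neval s i) (reval s e)
  | Seq c1 c2 => run c2 (run c1 s)
  | If b c1 c2 => if beval s b then run c1 s else run c2 s
  end.

(** Total correctness with a time bound: started in [s], the program halts
    within [T] steps in a state that satisfies [Q]. *)
Definition halts c s (T : nat) Q : Prop :=
  exists s' t, [/\ exec c s s' t, (t <= T)%N & Q s'].

Lemma halts_run c s Q : loop_free c -> Q (run c s) -> halts c s (time_bound c) Q.
Proof.
move=> lf hQ; exists (run c s).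
suff [t [h1 h2]] : exists t, exec c s (run c s) t /\ (t <= time_bound c)%N by exists t.
elim: c s lf {hQ} => //= [|a i e|a i e|c1 IH1 c2 IH2|b c1 IH1 c2 IH2] s.
- by exists 1%N; split=> //; constructor.
- by eexists; split; [constructor|].
- by eexists; split; [constructor|].
- case/andP => /(IH1 s) [t1 [e1 l1]] /(IH2 (run c1 s)) [t2 [e2 l2]].
  by exists (t1 + t2)%N; split; [apply: ExecSeq e1 e2|rewrite leq_add].
case/andP => /(IH1 s) [t1 [e1 l1]] /(IH2 s) [t2 [e2 l2]].
case E: (beval s b).
  by exists (bcost b + t1).+1; split; [constructor; rewrite E|lia].
by exists (bcost b + t2).+1; split; [constructor; rewrite E|lia].
Qed.

Lemma halts_seq c1 c2 s T1 T2 Q1 Q :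
  halts c1 s T1 Q1 -> (forall s', Q1 s' -> halts c2 s' T2 Q) ->
  halts (c1;; c2) s (T1 + T2) Q.
Proof.
case=> s1 [t1 [e1 l1 h1]] /(_ s1 h1) [s2 [t2 [e2 l2 h2]]].
by exists s2, (t1 + t2)%N; split=> //; [apply: ExecSeq e1 e2|rewrite leq_add].
Qed.

Lemma halts_seq_run c1 c2 s T Q : loop_free c1 ->
  halts c2 (run c1 s) T Q -> halts (c1;; c2) s (time_bound c1 + T) Q.
Proof.
move=> lf h; apply: (halts_seq (Q1 := eq (run c1 s))); first exact: halts_run.
by move=> _ <-.
Qed.

Lemma halts_if b c1 c2 s T Q :
  halts (if beval s b then c1 else c2) s T Q ->
  halts (If b c1 c2) s (bcost b + T).+1 Q.
Proof.
case=> s1 [t1 [e1 l1 h1]]; exists s1, (bcost b + t1).+1; split=> //.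
  exact: ExecIf.
by rewrite ltnS leq_add2l.
Qed.

Lemma halts_mono c s T T' Q Q' :
  halts c s T Q -> (T <= T')%N -> (forall s', Q s' -> Q' s') -> halts c s T' Q'.
Proof.
case=> s1 [t1 [e1 l1 h1]] le QQ; exists s1, t1; split=> //; last exact: QQ.
exact: leq_trans le.
Qed.

(** A frame condition at the granularity of whole arrays, so that its side
    conditions are decided by computation. *)
Definition unchanged c s s' : Prop :=
  (forall a i, a \notin nwrites c -> nmem s' a i = nmem s a i) /\
  (forall a i, a \notin rwrites c -> rmem s' a i = rmem s a i).

Lemma unchanged_trans c s1 s2 s3 :
  unchanged c s1 s2 -> unchanged c s2 s3 -> unchanged c s1 s3.
Proof.
by move=> [n1 r1] [n2 r2]; split=> a i ha; rewrite ?n2 ?r2 // ?n1 ?r1.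
Qed.

Lemma unchanged_sub c c' s s' :
  {subset nwrites c <= nwrites c'} -> {subset rwrites c <= rwrites c'} ->
  unchanged c s s' -> unchanged c' s s'.
Proof.
move=> nsub rsub [h1 h2]; split=> a i ha; [apply: h1|apply: h2].
  exact: contra (nsub a) ha.
exact: contra (rsub a) ha.
Qed.

Lemma exec_unchanged c s s' t : exec c s s' t -> unchanged c s s'.
Proof.
elim=> {c s s' t} //.
- move=> s a i e; split=> // a' i' /=.
  by rewrite inE => /negPf; rewrite /upd => ->.
- move=> s a i e; split=> // a' i' /=.
  by rewrite inE => /negPf; rewrite /upd => ->.
- move=> s1 s2 s3 c1 c2 t1 t2 _ h1 _ h2; apply: (@unchanged_trans _ _ s2).
    by apply: unchanged_sub h1 => a /=; rewrite mem_cat => ->.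
  by apply: unchanged_sub h2 => a /=; rewrite mem_cat orbC => ->.
- move=> s s' b c1 c2 t _; apply: unchanged_sub => a /=; rewrite mem_cat;
  by case: (beval s b) => ->; rewrite ?orbT.
by move=> s1 s2 s3 b c t1 t2 _ _ h1 _; apply: unchanged_trans.
Qed.

Lemma halts_unchanged c s T Q :
  halts c s T Q -> halts c s T (fun s' => Q s' /\ unchanged c s s').
Proof.
case=> s1 [t1 [e1 l1 h1]]; exists s1, t1; split=> //; split=> //.
exact: exec_unchanged e1.
Qed.

Lemma unchanged_run c s : loop_free c -> unchanged c s (run c s).
Proof.
move=> lf; have [s' [t [/exec_unchanged + _ sE]]] := halts_run lf (erefl (run c s)).
by rewrite sE.
Qed.

(** The index of the invariant counts the iterations that may still follow; each of
    them takes at most [T] steps.  The invariant need not speak of the arrays that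
    the body leaves alone, since [unchanged] is available throughout. *)
Lemma halts_while b c s0 k T (Inv : nat -> state -> Prop) Q :
  Inv k s0 ->
  (forall j s, unchanged c s0 s -> Inv j s -> beval s b ->
    exists2 j', j = j'.+1 & halts c s T (Inv j')) ->
  (forall j s, unchanged c s0 s -> Inv j s -> ~~ beval s b -> Q s) ->
  halts (While b c) s0 (k.+1 * (T + bcost b).+1) Q.
Proof.
move=> h0 step fin.
suff main j s : unchanged c s0 s -> Inv j s ->
    halts (While b c) s (j.+1 * (T + bcost b).+1) Q by exact: main.
elim: j s => [|j IHj] s us hs; have [bs|bs] := boolP (beval s b).
- by case: (step _ _ us hs bs).
- exists s, (bcost b).+1; split; [exact: ExecWhileFalse|lia|exact: fin hs bs].
- have [j' [<-] ht] := step _ _ us hs bs.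
  have [s1 [t1 [e1 l1 [h1 u1]]]] := halts_unchanged ht.
  have [s2 [t2 [e2 l2 h2]]] := IHj s1 (unchanged_trans us u1) h1.
  exists s2, (bcost b + t1 + t2).+1; split=> //; first exact: ExecWhileTrue e1 e2.
  by rewrite mulSn; lia.
exists s, (bcost b).+1; split; [exact: ExecWhileFalse|rewrite mulSn; lia|exact: fin hs bs].
Qed.

(** [J k] describes the memory before the [k]th iteration, with the counter
    already set to [k]. *)
Lemma halts_for i bnd c s0 n T (J : nat -> state -> Prop) Q :
  i \notin nwrites c ->
  (forall s, unchanged (for_loop i bnd c) s0 s -> neval s bnd = n) ->
  J 0%N (setn s0 i 0 0) ->
  (forall k s, unchanged (for_loop i bnd c) s0 s -> (k < n)%N -> nmem s i 0 = k ->
     J k s -> halts c s T (fun s' => J k.+1 (setn s' i 0 k.+1))) ->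
  (forall s, unchanged (for_loop i bnd c) s0 s -> J n s -> Q s) ->
  halts (for_loop i bnd c) s0 (n.+1 * (T + ncost bnd + 14)) Q.
Proof.
move=> ic bndE J0 step fin.
pose loop := While (BNLt (nvar i) bnd) (c;; nassign i (NAdd (nvar i) (NConst 1))).
have u0 : unchanged (for_loop i bnd c) s0 (setn s0 i 0 0).
  have := @exec_unchanged _ _ _ _ (ExecNSet s0 i (NConst 0) (NConst 0)).
  by apply: unchanged_sub => a //=; rewrite !inE => ->.
have ul s : unchanged (c;; nassign i (NAdd (nvar i) (NConst 1))) (setn s0 i 0 0) s ->
    unchanged (for_loop i bnd c) s0 s.
  move=> us; apply: unchanged_trans u0 _; apply: unchanged_sub us => a //=.
  by rewrite inE => ->; rewrite orbT.
apply: (@halts_mono _ _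
   (time_bound (nassign i (NConst 0)) + n.+1 * (T + 6 + bcost (BNLt (nvar i) bnd)).+1) _ Q).
- apply: halts_seq_run => //=.
  pose Inv j s := exists k, [/\ (k + j)%N = n, nmem s i 0 = k & J k s].
  apply: (@halts_while _ _ _ _ _ Inv).
  + by exists 0%N; split=> //; rewrite /= /upd !eqxx.
  + move=> j s /ul us [k [kj ki Jk]] /=; rewrite (bndE _ us) ki -ltnNge => kn.
    exists j.-1; first by lia.
    apply: (@halts_mono _ _ (T + time_bound (nassign i (NAdd (nvar i) (NConst 1)))) _ (Inv j.-1)) => //.
    apply: halts_seq; first exact/halts_unchanged/(step k).
    move=> s' [hJ us']; apply: halts_run => //=; have := us'.1 i 0%N ic => ki'.
    exists k.+1; split; first by lia.
      by rewrite /= /upd !eqxx /= ki' ki addn1.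
    by rewrite ki' ki addn1.
  + move=> j s /ul us [k [kj ki Jk]] /=; rewrite (bndE _ us) ki negbK => nk.
    by apply: fin => //; have -> : n = k by lia.
- by rewrite /=; nia.
by [].
Qed.

End Logic.

(** * Counting along the branches of a rooted tree *)

Section Strip.
Variables (V E : finType) (ends : E -> V * V).
Hypothesis tree : is_tree ends.
Variables (x : V) (par : V -> V) (pe : V -> E).
Hypothesis root : rooted ends x par pe.
Local Notation P := (path_set ends).

Lemma pe_imset : pe @: [set~ x] = setT.
Proof.
apply/setP => e; rewrite in_setT; have [v vx <-] := pe_surj tree root e.
by rewrite imset_f // in_setC1.
Qed.

Lemma pe_in_inj : {in [set~ x] &, injective pe}.
Proof.
by move=> v w; rewrite !in_setC1; apply: (pe_inj root).
Qed.

Lemma card_edges : #|E|.+1 = #|V|.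
Proof.
rewrite -[#|E|]cardsT -pe_imset (card_in_imset pe_in_inj) cardsC1 prednK //.
by apply/card_gt0P; exists x.
Qed.

Definition children (v : V) : {set V} := [set z | (z != x) && (par z == v)].

Lemma childrenP z v : reflect (z != x /\ par z = v) (z \in children v).
Proof. by rewrite inE; apply: (iffP andP) => -[h /eqP]. Qed.

Lemma child_par z : z != x -> z \in children (par z).
Proof. by move=> zx; apply/childrenP. Qed.

Definition incidence (e : E) (v : V) : nat :=
  ((ends e).1 == v) + ((ends e).2 == v).

(** What remains at [v] of a sum over the incident edges when the edges
    between the vertices of [W] and their parents have been deleted. *)
Definition residual (f : E -> nat) (W : {set V}) (v : V) : nat :=
  ((v != x) * f (pe v) + \sum_(z in children v :\: W) f (pe z))%N.

(** Every edge is [pe z] for exactly one [z], and its ends are [z] and [par z]. *)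
Lemma incidence_sum f v :
  (\sum_e incidence e v * f e)%N = residual f set0 v.
Proof.
have -> : (\sum_e incidence e v * f e = \sum_(e in pe @: [set~ x]) incidence e v * f e)%N.
  by apply: eq_bigl => e; rewrite pe_imset in_setT.
rewrite (big_imset _ pe_in_inj) /=.
rewrite (eq_bigr (fun z => (z == v) * f (pe z) + (par z == v) * f (pe z))%N).
  rewrite big_split /= /residual setD0; congr (_ + _)%N; last first.
    rewrite [RHS](eq_bigl (fun z => (z \in [set~ x]) && (par z == v))); last first.
      by move=> z; rewrite inE in_setC1.
    by rewrite big_mkcondr; apply: eq_bigr => z _; case: eqP; rewrite ?mul1n.
  have [vx|vx] := boolP (v != x).
    rewrite (bigD1 v) ?in_setC1 //= eqxx big1 ?addn0 // => z /andP[_ /negPf ->].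
    by rewrite mul0n.
  rewrite big1 ?mul0n // => z; rewrite in_setC1 => zx; have [zv|] := eqVneq z v => //.
  by rewrite -zv zx in vx.
move=> z; rewrite in_setC1 => zx; rewrite -mulnDl; congr muln; rewrite /incidence.
by case/orP: (rooted_joins root zx) => /eqP ->; rewrite //= addnC.
Qed.

Lemma residual_step f (W : {set V}) v u : v != x -> v \notin W ->
  (residual f W u = residual f (v |: W) u + (par v == u) * f (pe v))%N.
Proof.
move=> vx vW; rewrite /residual -addnA; congr addn.
have [uv|uv] := eqVneq (par v) u.
  have vD : v \in children u :\: W by rewrite in_setD vW; apply/childrenP.
  rewrite (big_setD1 v vD) /= mul1n addnC; congr addn; apply: eq_bigl => z.
  by rewrite !in_setD in_set1 in_setU1 negb_or andbA.
rewrite addn0; apply: eq_bigl => z; rewrite !in_setD in_setU1 negb_or.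
have [->|//] := eqVneq z v; rewrite vW /=.
by apply/negP => /childrenP [_ h]; rewrite h eqxx in uv.
Qed.

Lemma residual_leaf f (W : {set V}) v : v != x -> children v \subset W ->
  residual f W v = f (pe v).
Proof.
rewrite /residual -setD_eq0 => -> /eqP ->.
by rewrite big_set0 addn0 mul1n.
Qed.

Lemma residual_one W v :
  residual (fun=> 1%N) W v = ((v != x) + #|children v :\: W|)%N.
Proof. by rewrite /residual muln1 sum1_card. Qed.

(** Number of vertices of [S] in the branch that hangs from [pe v]. *)
Definition below (S : {set V}) (v : V) : nat := #|[set s in S | pe v \in P x s]|.

(** A path from [x] to [s] that crosses [pe v] stops at [v] or goes on through
    exactly one child of [v]. *)
Lemma below_rec (S : {set V}) v : v != x ->
  below S v = ((v \in S) + \sum_(z in children v) below S z)%N.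
Proof.
move=> vx.
have belowE z : below S z = \sum_(s in S) (pe z \in P x s).
  rewrite /below -sum1_card (eq_bigl (fun s => (s \in S) && (pe z \in P x s))).
    by rewrite big_mkcondr; apply: eq_bigr => s _; case: (_ \in _).
  by move=> s; rewrite in_set.
rewrite belowE (eq_bigr _ (fun z _ => belowE z)) exchange_big /=.
have -> : (v \in S) = \sum_(s in S) (s == v) :> nat.
  have [vS|vS] := boolP (v \in S).
    by rewrite (bigD1 v vS) /= eqxx big1 // => s /andP[_ /negPf ->].
  by rewrite big1 // => s sS; have [sv|//] := eqVneq s v; rewrite -sv sS in vS.
rewrite -big_split; apply: eq_bigr => s _ /=.
elim/(rooted_ind root): s => [|s sx IHs].
  rewrite path_set_xx // in_set0 (negPf (_ : x != v)) 1?eq_sym //.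
  by rewrite big1 // => z _; rewrite in_set0.
have pathE z : z != x -> (pe z \in P x s) = (z == s) + (pe z \in P x (par s)) :> nat.
  move=> zx; rewrite (rooted_path root sx) in_setU1.
  have [->|zs] := eqVneq z s; first by rewrite eqxx (negPf (rooted_fresh root sx)).
  by rewrite (negPf (_ : pe z != pe s)) //; apply: contra zs => /eqP /(pe_inj root zx sx) ->.
rewrite pathE // IHs [v == s]eq_sym; congr addn.
rewrite [RHS](eq_bigr (fun z => (z == s) + (pe z \in P x (par s)))%N); last first.
  by move=> z /childrenP [zx _]; rewrite pathE.
rewrite big_split /=; congr addn.
have [sv|sv] := eqVneq (par s) v.
  have sc : s \in children v by apply/childrenP.
  by rewrite (bigD1 s sc) /= eqxx big1 // => z /andP[_ /negPf ->].
rewrite big1 // => z /childrenP [_ zv]; have [zs|//] := eqVneq z s.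
by rewrite -zs zv eqxx in sv.
Qed.

(** The part of a bottom-up count that has arrived at [v] when the vertices of
    [W] have been passed to their parents. *)
Definition collected (S W : {set V}) (v : V) : nat :=
  ((v \in S) + \sum_(z in children v :&: W) below S z)%N.

Lemma collected_step (S W : {set V}) v u : v != x -> v \notin W ->
  (collected S (v |: W) u = collected S W u + (par v == u) * below S v)%N.
Proof.
move=> vx vW; rewrite /collected -addnA; congr addn.
have [uv|uv] := eqVneq (par v) u.
  have vD : v \in children u :&: (v |: W).
    by rewrite in_setI setU11 andbT; apply/childrenP.
  rewrite (big_setD1 v vD) /= mul1n addnC; congr addn; apply: eq_bigl => z.
  rewrite in_setD1 !in_setI in_setU1; have [->|//] := eqVneq z v.
  by rewrite (negPf vW) andbF.
rewrite addn0; apply: eq_bigl => z; rewrite !in_setI in_setU1.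
have [->|//] := eqVneq z v; rewrite (negPf vW) andbF.
by apply/negP => /andP[/childrenP [_ h] _]; rewrite h eqxx in uv.
Qed.

Lemma collected_full (S W : {set V}) v : v != x -> children v \subset W ->
  collected S W v = below S v.
Proof. by move=> vx /setIidPl h; rewrite /collected h -below_rec. Qed.

Lemma mem_trunk_below (S : {set V}) v : v != x ->
  (pe v \in trunk ends x S) = (below S v == #|S|).
Proof.
move=> vx; have sub : [set s in S | pe v \in P x s] \subset S.
  by apply/subsetP => s; rewrite in_set => /andP[].
apply/trunkP/eqP => [h|h].
  apply: eq_card => s; rewrite in_set.
  by case sS: (s \in S) => //=; apply: h.
have := subset_cardP h sub => eqS s; rewrite -eqS => /setIdP[]//.
Qed.

(** Induction from the deepest vertices upwards. *)
Lemma children_closed (W : {set V}) : (forall v, v != x -> children v \subset W -> v \in W) ->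
  forall v, v != x -> v \in W.
Proof.
move=> closed v; have [k] := ubnP (#|E| - #|P x v|).
elim: k v => // k IHk v hk vx; apply: closed => //; apply/subsetP => z.
case/childrenP => zx zv; apply: IHk => //.
have := card_path_par root zx; rewrite zv => hz.
have hm : (#|P x z| <= #|E|)%N by apply: max_card.
by move: hk hz hm; lia.
Qed.

End Strip.

(** * Hanging the tree at a root *)

(* Names of memory cells: [v] for scalars, [a] for arrays of naturals, [r] for
   reals. *)
Local Notation vI := 10%N (only parsing).
Local Notation aDEG := 11%N (only parsing).
Local Notation aSM := 12%N (only parsing).
Local Notation aCNT := 13%N (only parsing).
Local Notation vTOT := 14%N (only parsing).
Local Notation aQ := 15%N (only parsing).
Local Notation vQH := 16%N (only parsing).
Local Notation vQT := 17%N (only parsing).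
Local Notation vV := 18%N (only parsing).
Local Notation vE := 19%N (only parsing).
Local Notation vU := 20%N (only parsing).

Definition in_n : nexp := NGet 0 (NConst 0).
Definition in_m : nexp := NGet 0 (NConst 1).
Definition in_a : nexp := NGet 0 (NConst 2).
Definition in_b : nexp := NGet 0 (NConst 3).

Section Inputs.
Variables (R : realFieldType) (n m : nat) (I : instance R 'I_n 'I_m).

Definition inputs (s : state R) : Prop :=
  (forall a i, (a < 3)%N -> nmem s a i = nmem (input_state I) a i) /\
  (forall a i, (a < 4)%N -> rmem s a i = rmem (input_state I) a i).

Lemma inputs_unchanged c s s' :
  all (leq 3) (nwrites c) -> all (leq 4) (rwrites c) ->
  unchanged c s s' -> inputs s -> inputs s'.
Proof.
move=> /allP nc /allP rc [u1 u2] [i1 i2]; split=> a i ha.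
  by rewrite u1 ?i1 //; apply/negP => /nc; rewrite leqNgt ha.
by rewrite u2 ?i2 //; apply/negP => /rc; rewrite leqNgt ha.
Qed.

Lemma inputs_setn s a i v : (2 < a)%N -> inputs s -> inputs (setn s a i v).
Proof.
move=> ha [i1 i2]; split=> a' i' ha'; last exact: i2.
rewrite -i1 //= /upd; by case: eqP => // h; rewrite h ltnNge ha in ha'.
Qed.

Lemma array_ofE (T : Type) k (x0 : T) (f : 'I_k -> T) (j : 'I_k) :
  array_of x0 f j = f j.
Proof. by rewrite /array_of valK. Qed.

Variable s : state R.
Hypothesis ins : inputs s.

Lemma in_nE : nmem s 0 0 = n. Proof. by rewrite ins.1. Qed.
Lemma in_mE : nmem s 0 1 = m. Proof. by rewrite ins.1. Qed.
Lemma in_aE : nmem s 0 2 = leaf_a I. Proof. by rewrite ins.1. Qed.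
Lemma in_bE : nmem s 0 3 = leaf_b I. Proof. by rewrite ins.1. Qed.
Lemma in_end1 e : nmem s 1 (nat_of_ord e) = (ends I e).1.
Proof. by rewrite ins.1 //= array_ofE. Qed.
Lemma in_end2 e : nmem s 2 (nat_of_ord e) = (ends I e).2.
Proof. by rewrite ins.1 //= array_ofE. Qed.
Lemma in_weight v : rmem s 0 (nat_of_ord v) = weight I v.
Proof. by rewrite ins.2 //= array_ofE. Qed.
Lemma in_len e : rmem s 1 (nat_of_ord e) = len I e.
Proof. by rewrite ins.2 //= array_ofE. Qed.
Lemma in_bound e : rmem s 2 (nat_of_ord e) = bound I e.
Proof. by rewrite ins.2 //= array_ofE. Qed.
Lemma in_ucost e : rmem s 3 (nat_of_ord e) = ucost I e.
Proof. by rewrite ins.2 //= array_ofE. Qed.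

End Inputs.

Section HangProgram.
(** [rt] computes the root and [sel] decides membership of a vertex in the set
    to be counted. *)
Variables (rt : nexp) (sel : nexp -> bexp).

Definition clear_body : cmd :=
  NSet aDEG (nvar vI) (NConst 0);; NSet aSM (nvar vI) (NConst 0);;
  If (sel (nvar vI))
    (NSet aCNT (nvar vI) (NConst 1);; nassign vTOT (NAdd (nvar vTOT) (NConst 1)))
    (NSet aCNT (nvar vI) (NConst 0)).
Definition clear_prog : cmd :=
  nassign vTOT (NConst 0);; for_loop vI in_n clear_body.

(** [aSM] receives at each vertex the sum of the indices of the incident edges.
    Together with the degree it replaces adjacency lists: when all but one of
    these edges are removed, the sum is the index of the last one. *)
Definition degree_half (k : nat) : cmd :=
  nassign vV (NGet k (nvar vI));;
  NSet aDEG (nvar vV) (NAdd (NGet aDEG (nvar vV)) (NConst 1));;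
  NSet aSM (nvar vV) (NAdd (NGet aSM (nvar vV)) (nvar vI)).
Definition degree_body : cmd := degree_half 1;; degree_half 2.
Definition degree_prog : cmd := for_loop vI in_m degree_body.

Definition push_if_leaf (v : nexp) : cmd :=
  If (BAnd (BNEq (NGet aDEG v) (NConst 1)) (BNot (BNEq v rt)))
    (NSet aQ (nvar vQT) v;; nassign vQT (NAdd (nvar vQT) (NConst 1))) Skip.
Definition queue_prog : cmd :=
  nassign vQT (NConst 0);; for_loop vI in_n (push_if_leaf (nvar vI)).

(** The other end of an edge is the sum of both ends minus the known one. *)
Definition load_edge : cmd :=
  nassign vE (NGet aSM (nvar vV));;
  nassign vU (NSub (NAdd (NGet 1 (nvar vE)) (NGet 2 (nvar vE))) (nvar vV)).
Definition detach : cmd :=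
  NSet aDEG (nvar vU) (NSub (NGet aDEG (nvar vU)) (NConst 1));;
  NSet aSM (nvar vU) (NSub (NGet aSM (nvar vU)) (nvar vE));;
  NSet aCNT (nvar vU) (NAdd (NGet aCNT (nvar vU)) (NGet aCNT (nvar vV))).
(** Takes a leaf from the queue, removes it, and passes its count to the remaining
    neighbour, which is its parent because the root is never queued. *)
Definition strip_body : cmd :=
  nassign vV (NGet aQ (nvar vQH));;
  load_edge;;
  detach;;
  push_if_leaf (nvar vU);;
  nassign vQH (NAdd (nvar vQH) (NConst 1)).
Definition strip_prog : cmd :=
  nassign vQH (NConst 0);; While (BNLt (nvar vQH) (nvar vQT)) strip_body.

Definition hang_prog : cmd := clear_prog;; degree_prog;; queue_prog;; strip_prog.

Variable R : realFieldType.
Variables (n m : nat) (I : instance R 'I_n 'I_m).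
Hypothesis valI : valid I.
Let tree := valid_tree valI.
Variables (x : 'I_n) (S : {set 'I_n}) (par : 'I_n -> 'I_n) (pe : 'I_n -> 'I_m).
Hypothesis root : rooted (ends I) x par pe.
Hypothesis rtE : forall s, inputs I s -> neval s rt = x.
Hypothesis selE : forall s i (v : 'I_n), inputs I s -> neval s i = v ->
  beval s (sel i) = (v \in S).

Lemma sum_ord_ltS (F : 'I_m -> nat) k (kn : (k < m)%N) :
  (\sum_(e < m | e < k.+1) F e = \sum_(e < m | e < k) F e + F (Ordinal kn))%N.
Proof.
rewrite (bigD1 (Ordinal kn)) /= ?ltnSn // addnC; congr addn; apply: eq_bigl => e.
by rewrite -val_eqE /= ltnS ltn_neqAle andbC.
Qed.

Lemma clear_halts s0 : inputs I s0 ->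
  halts clear_prog s0 (n.+1 * (time_bound clear_body + 20)) (fun s =>
    [/\ forall v : 'I_n, nmem s aDEG v = 0%N, forall v : 'I_n, nmem s aSM v = 0%N,
        forall v : 'I_n, nmem s aCNT v = (v \in S) & nmem s vTOT 0 = #|S|]).
Proof.
move=> in0; set T := (n.+1 * _)%N.
pose J k (s : state R) := nmem s vTOT 0 = #|[set v in S | v < k]%N| /\
  forall v : 'I_n, (v < k)%N ->
  [/\ nmem s aDEG v = 0%N, nmem s aSM v = 0%N & nmem s aCNT v = (v \in S)].
apply: (@halts_mono _ _ _ (3 + n.+1 * (time_bound clear_body + ncost in_n + 14))
  _ (J n)); last 2 first.
- by rewrite /T /=; nia.
- move=> s [h1 h2]; split=> [v|v|v|]; try by case: (h2 v (ltn_ord v)).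
  by rewrite h1; apply: eq_card => v; rewrite in_set ltn_ord andbT.
apply: halts_seq_run => //; set s1 := run _ _.
have in1 : inputs I s1 by apply: inputs_setn.
apply: (halts_for (J := J)) => //=.
- by move=> s u; apply: (in_nE (I := I)); apply: inputs_unchanged u in1.
- split=> [|v]; last by rewrite ltn0.
  rewrite /s1 /= /upd /=.
  by rewrite (_ : [set v in S | v < 0]%N = set0) ?cards0 //; apply/setP => w; rewrite !inE andbF.
move=> k s u kn kI [h1 h2].
have is_ : inputs I s by apply: inputs_unchanged u in1.
pose w := Ordinal kn.
have cardS : #|[set v in S | (v < k.+1)%N]| = ((w \in S) + #|[set v in S | (v < k)%N]|)%N.
  have [wS|wS] := boolP (w \in S).
    rewrite (cardsD1 w) in_set wS ltnSn; congr (_ + _)%N; apply: eq_card => v.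
    rewrite !inE -val_eqE /= ltnS [(v <= k)%N]leq_eqVlt; case: eqP => [->|_] //=.
    by rewrite ltnn andbF.
  apply: eq_card => v; rewrite !inE ltnS leq_eqVlt; case: eqP => //= vk.
  by rewrite (_ : v = w) ?(negPf wS) //; apply: val_inj.
apply: halts_run => //.
rewrite /= (selE (v := w)); last 2 first.
- by do 2!apply: inputs_setn => //.
- by rewrite /= /upd /= kI.
rewrite /J cardS -h1; case: (boolP (w \in S)) => wS; rewrite /= /upd /= ?kI.
  split=> [|v]; first by rewrite addnC.
  rewrite ltnS leq_eqVlt; case: eqP => [vk _|_ /h2//].
  by rewrite (_ : v = w) ?wS //; apply: val_inj.
split=> // v; rewrite ltnS leq_eqVlt; case: eqP => [vk _|_ /h2//].
by rewrite (_ : v = w) ?(negPf wS) //; apply: val_inj.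
Qed.

Lemma run_degree_half k (s : state R) (e : 'I_m) (u : 'I_n) :
  nmem s k (nmem s vI 0) = u -> nmem s vI 0 = e ->
  forall v : 'I_n,
    nmem (run (degree_half k) s) aDEG v = (nmem s aDEG v + (u == v))%N /\
    nmem (run (degree_half k) s) aSM v = (nmem s aSM v + (u == v) * e)%N.
Proof.
move=> hu he v; rewrite he in hu.
rewrite /= /upd /= he hu (inj_eq val_inj) [u == v]eq_sym /=.
by case: eqP => [->|_]; rewrite ?addn0 ?muln1 ?mul1n.
Qed.

Lemma degree_halts s0 : inputs I s0 ->
  (forall v : 'I_n, nmem s0 aDEG v = 0%N) -> (forall v : 'I_n, nmem s0 aSM v = 0%N) ->
  halts degree_prog s0 (m.+1 * (time_bound degree_body + 20)) (fun s =>
    forall v : 'I_n, nmem s aDEG v = residual x par pe (fun=> 1%N) set0 v /\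
      nmem s aSM v = residual x par pe val set0 v).
Proof.
move=> in0 d0 s0E.
pose J k (s : state R) := forall v : 'I_n,
  nmem s aDEG v = (\sum_(e < m | e < k) incidence (ends I) e v)%N /\
  nmem s aSM v = (\sum_(e < m | e < k) incidence (ends I) e v * e)%N.
apply: (@halts_mono _ _ _ (m.+1 * (time_bound degree_body + ncost in_m + 14))
  _ (J m)); last 2 first.
- by rewrite leq_mul2l /=; lia.
- move=> s hs v; have [-> ->] := hs v.
  rewrite -!(incidence_sum tree root); split.
    by apply: eq_big => e *; rewrite ?ltn_ord ?muln1.
  by apply: eq_bigl => e; rewrite ltn_ord.
apply: (halts_for (J := J)) => //=.
- by move=> s u; apply: (in_mE (I := I)); apply: inputs_unchanged u in0.
- by move=> v; rewrite /= /upd /= d0 s0E !big_pred0.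
move=> k s u kn kI hs.
have is_ : inputs I s by apply: inputs_unchanged u in0.
pose e := Ordinal kn; pose s1 := run (degree_half 1) s.
apply: halts_run => //; suff : J k.+1 (run (degree_half 2) s1) by [].
move=> v.
have us1 : unchanged (degree_half 1) s s1 by apply: unchanged_run.
have is1 : inputs I s1 by apply: inputs_unchanged us1 is_.
have kI1 : nmem s1 vI 0 = e by rewrite us1.1.
have [] := @run_degree_half 1 s e (ends I e).1 (_ : _ = _) kI v.
  by rewrite kI (in_end1 is_ e).
have [] := @run_degree_half 2 s1 e (ends I e).2 (_ : _ = _) kI1 v.
  by rewrite kI1 (in_end2 is1 e).
have [h1 h2] := hs v; rewrite -/s1 => -> -> -> ->.
by rewrite h1 h2 !(sum_ord_ltS _ kn) /incidence mulnDl !addnA.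
Qed.

Definition stored (q : seq 'I_n) (s : state R) : Prop :=
  nmem s vQT 0 = size q /\
  forall i, (i < size q)%N -> nmem s aQ i = nth x q i.

Lemma run_push q (s : state R) i (v : 'I_n) :
  inputs I s -> neval s i = v -> stored q s ->
  stored (if (nmem s aDEG v == 1%N) && (v != x) then rcons q v else q)
    (run (push_if_leaf i) s).
Proof.
move=> is_ iv [h1 h2]; rewrite /push_if_leaf /=. rewrite !iv (rtE is_) -!eqn_leq (inj_eq val_inj).
case: ifP => // _; split=> [|j]; first by rewrite /= /upd /= h1 size_rcons addn1.
rewrite size_rcons ltnS /= /upd /= nth_rcons h1 => jq.
by case: ltngtP jq => // jq _; rewrite h2.
Qed.

Lemma queue_halts s0 : inputs I s0 ->
  halts queue_prog s0 (n.+1 * (time_bound (push_if_leaf (nvar vI)) + 20)) (fun s =>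
    exists q, [/\ stored q s, uniq q &
      forall v, (v \in q) = (nmem s0 aDEG v == 1%N) && (v != x)]).
Proof.
move=> in0; set body := push_if_leaf (nvar vI).
pose J k (s : state R) := exists q, [/\ stored q s, uniq q &
      forall v : 'I_n, (v \in q) = [&& v < k, nmem s0 aDEG v == 1 & v != x]%N].
apply: (@halts_mono _ _ _ (3 + n.+1 * (time_bound body + ncost in_n + 14))
  _ (J n)); last 2 first.
- by rewrite /body /=; nia.
- move=> s [q [h1 h2 h3]]; exists q; split=> // v.
  by rewrite h3 ltn_ord.
apply: halts_seq_run => //; set s1 := run _ _.
have in1 : inputs I s1 by apply: inputs_setn.
apply: (halts_for (J := J)) => //=.
- by move=> s u; apply: (in_nE (I := I)); apply: inputs_unchanged u in1.
- by exists [::]; split=> // v; rewrite ltn0.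
move=> k s u kn kI [q [h1 h2 h3]].
have is_ : inputs I s by apply: inputs_unchanged u in1.
pose w := Ordinal kn; have := @run_push q s (nvar vI) w is_ kI h1.
have -> : nmem s aDEG w = nmem s0 aDEG w by rewrite u.1.
set b := (_ && _) => h4; have wq : (w \in q) = false by rewrite h3 ltnn.
apply: halts_run => //; exists (if b then rcons q w else q); split=> // [|v].
  by case: b {h4}; rewrite ?rcons_uniq ?h2 ?wq.
rewrite ltnS leq_eqVlt; have [vk|vk] := eqVneq (v : nat) k.
  have -> : v = w by apply: val_inj.
  by rewrite -/b; case: b {h4}; rewrite ?mem_rcons ?inE ?eqxx ?wq.
rewrite -h3; case: b {h4} => //; rewrite mem_rcons inE.
by rewrite (negPf (_ : v != w)).
Qed.

Lemma run_load_edge (s : state R) v : inputs I s -> nmem s vV 0 = nat_of_ord v ->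
  v != x -> nmem s aSM v = pe v ->
  nmem (run load_edge s) vE 0 = pe v /\ nmem (run load_edge s) vU 0 = par v.
Proof.
move=> is_ sv vx sme; rewrite /= /upd /= sv sme (in_end1 is_) (in_end2 is_).
split=> //; case/orP: (rooted_joins root vx) => /eqP -> /=; first by rewrite addKn.
by rewrite addnK.
Qed.

(** The outcome of hanging the tree at [x]: the queue lists the other vertices,
    children before parents. *)
Definition hung (q : seq 'I_n) (s : state R) : Prop :=
  [/\ stored q s, uniq q /\ (forall v, (v \in q) = (v != x)),
      forall z, z != x -> par z != x -> (index z q < index (par z) q)%N,
      forall v, v != x -> nmem s aSM v = pe v /\ nmem s aCNT v = below (ends I) x pe S v
    & nmem s vTOT 0 = #|S|].

(** [W] is the set of removed vertices; the queue holds it and the vertices that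
    are now leaves. *)
Definition strip_inv (j : nat) (s : state R) : Prop :=
  exists (q : seq 'I_n) (k : nat), let W := [set z in take k q] in
  [/\ [/\ (k + j)%N = n, nmem s vQH 0 = k, (k <= size q)%N, stored q s & uniq q],
      forall v : 'I_n, (v \in q) = (v != x) && (children x par v \subset W),
      forall v z : 'I_n, v \in q -> z \in children x par v -> (index z q < index v q)%N
    & forall v : 'I_n, [/\ nmem s aDEG v = residual x par pe (fun=> 1%N) W v,
        nmem s aSM v = residual x par pe val W v
      & nmem s aCNT v = collected (ends I) x par pe S W v]].

Lemma strip_step j s : inputs I s -> strip_inv j s ->
  (nmem s vQH 0 < nmem s vQT 0)%N ->
  exists2 j', j = j'.+1 & strip_inv j' (run strip_body s).
Proof.
move=> is_ [q [k [[kj kQH kq [QT Qq] uq] ready order arr]]].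
rewrite kQH QT => {}kq; set W := [set z in take k q] in ready arr.
pose v := nth x q k; have vq : v \in q by apply: mem_nth.
have := vq; rewrite ready => /andP[vx vW].
have vnW : v \notin W.
  by rewrite in_set in_take // index_uniq // ltnn.
have kn : (k < n)%N.
  by apply: leq_trans kq _; have := max_card (mem q); rewrite (card_uniqP uq) card_ord.
have kj' : (k.+1 + j.-1 = n)%N by lia.
exists j.-1; first by lia.
have WE : [set z in take k.+1 q] = v |: W.
  by apply/setP => z; rewrite !inE (take_nth x kq) mem_rcons inE.
change (strip_inv j.-1 (run (nassign vQH (NAdd (nvar vQH) (NConst 1)))
  (run (push_if_leaf (nvar vU)) (run detach (run load_edge
    (run (nassign vV (NGet aQ (nvar vQH))) s)))))).
set s1 := run (nassign vV _) s.
have is1 : inputs I s1 by apply: inputs_setn.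
have s1V : nmem s1 vV 0 = v by rewrite /= /upd /= kQH Qq.
have us1 : unchanged (nassign vV (NGet aQ (nvar vQH))) s s1 by apply: unchanged_run.
clearbody s1.
(* [v] has no child left, so its index sum is down to the edge to its parent. *)
have s1SM : nmem s1 aSM v = pe v by rewrite us1.1 //; have [_ -> _] := arr v; rewrite residual_leaf.
have [s2E s2U] := run_load_edge is1 s1V vx s1SM.
set s2 := run load_edge s1 in s2E s2U *; set u := par v in s2U.
have us2 : unchanged load_edge s1 s2 by apply: unchanged_run.
clearbody s2.
have is2 : inputs I s2 by apply: inputs_unchanged us2 is1.
have s2V : nmem s2 vV 0 = v by rewrite us2.1.
have s2mem (a i : nat) : a \in [:: aDEG; aSM; aCNT] -> nmem s2 a i = nmem s a i.
  by rewrite !inE => /or3P[] /eqP ->; rewrite us2.1 // us1.1.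
have arr3 (w : 'I_n) : [/\
    nmem (run detach s2) aDEG w = residual x par pe (fun=> 1%N) (v |: W) w,
    nmem (run detach s2) aSM w = residual x par pe val (v |: W) w
  & nmem (run detach s2) aCNT w = collected (ends I) x par pe S (v |: W) w].
  have [_ _ cv] := arr v; rewrite (collected_full tree root) // in cv.
  have [] := arr w; rewrite !(residual_step _ _ _ w vx vnW) => dw sw cw.
  rewrite collected_step // /= /upd /= s2U s2E s2V !s2mem // -/u in dw sw *.
  rewrite (inj_eq val_inj) [w == u]eq_sym.
  move: dw sw cw; case: (eqVneq u w) => [<-|_] dw sw cw.
    by rewrite dw sw cw cv !mul1n !addnK.
  by rewrite dw sw cw !mul0n !addn0.
have us3 : unchanged detach s2 (run detach s2) by apply: unchanged_run.
have is3 : inputs I (run detach s2) by apply: inputs_unchanged us3 is2.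
move: (run detach s2) => s3 in arr3 us3 is3 *.
have st3 : stored q s3.
  split=> [|i iq]; first by rewrite us3.1 // us2.1 // us1.1.
  by rewrite us3.1 // us2.1 // us1.1 // Qq.
have kQH3 : nmem s3 vQH 0 = k by rewrite us3.1 // us2.1 // us1.1.
have s3U : nmem s3 vU 0 = u by rewrite us3.1.
have := @run_push q s3 (nvar vU) u is3 s3U st3.
set fresh := (_ && _); set q' := if fresh then _ else _.
have us4 : unchanged (push_if_leaf (nvar vU)) s3 (run (push_if_leaf (nvar vU)) s3).
  exact: unchanged_run.
move: (run (push_if_leaf (nvar vU)) s3) us4 => s4 us4 st4.
have vcu : v \in children x par u by apply: child_par.
(* [u] had the unremoved child [v] until now. *)
have unq : u \notin q.
  rewrite ready negb_and; apply/orP; right; apply/subsetPn; exists v => //.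
have freshE : fresh = (u != x) && (children x par u \subset v |: W).
  rewrite /fresh andbC; have [ux|//] := boolP (u != x).
  have [-> _ _] := arr3 u; rewrite residual_one ux -setD_eq0 -cards_eq0.
  by case: #|_|.
have takeq' : take k.+1 q' = take k.+1 q.
  by rewrite /q'; case: (fresh) => //; rewrite -cats1 takel_cat.
exists q', k.+1; rewrite takeq' WE; split.
- split=> //.
  + by rewrite /= /upd /= us4.1 // kQH3 addn1.
  + by rewrite /q'; case: (fresh); rewrite ?size_rcons // ltnW.
  + by rewrite /q'; case: (fresh); rewrite ?rcons_uniq ?unq.
- move=> w; have [->|wu] := eqVneq w u.
    rewrite -freshE /q'; case: (fresh); last by rewrite (negPf unq).
    by rewrite mem_rcons inE eqxx.
  have -> : (w \in q') = (w \in q).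
    by rewrite /q'; case: (fresh) => //; rewrite mem_rcons inE (negPf wu).
  rewrite ready; congr andb; apply/idP/idP => /subsetP sub; apply/subsetP => z zw.
    by rewrite in_setU1 sub ?orbT.
  have := sub z zw; rewrite in_setU1 => /orP[/eqP zv|//].
  by move/childrenP: zw => [_ zw]; rewrite -zw zv eqxx in wu.
- move=> w z; have [->|wu] := eqVneq w u.
    rewrite /q'; case E: (fresh); last by rewrite (negPf unq).
    move=> _ zu; have zW : z \in take k.+1 q.
      move: freshE; rewrite E => /esym /andP[_ /subsetP /(_ z zu)].
      by rewrite -WE in_set.
    rewrite -cats1 !index_cat (negPf unq) (mem_take zW) /= eqxx addn0.
    by rewrite index_mem (mem_take zW).
  have -> : (w \in q') = (w \in q).
    by rewrite /q'; case: (fresh) => //; rewrite mem_rcons inE (negPf wu).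
  move=> wq zw; have := order w z wq zw.
  have zq : z \in q by rewrite -index_mem; apply: ltn_trans (order w z wq zw) _; rewrite index_mem.
  by rewrite /q'; case: (fresh) => //; rewrite -cats1 !index_cat zq wq.
move=> w; rewrite /= /upd /= !us4.1 //.
Qed.

(** An empty queue means that everything but the root has been removed, by
    [children_closed]. *)
Lemma strip_halts s0 q : inputs I s0 -> stored q s0 -> uniq q ->
  (forall v, (v \in q) = (v != x) && (nmem s0 aDEG v == 1)%N) ->
  (forall v : 'I_n, [/\ nmem s0 aDEG v = residual x par pe (fun=> 1%N) set0 v,
      nmem s0 aSM v = residual x par pe val set0 v & nmem s0 aCNT v = (v \in S)]) ->
  nmem s0 vTOT 0 = #|S| ->
  halts strip_prog s0 (n.+1 * (time_bound strip_body + 20)) (fun s =>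
    exists q, hung q s).
Proof.
move=> in0 st0 uq qE arr tot.
pose s1 := run (nassign vQH (NConst 0)) s0.
have in1 : inputs I s1 by apply: inputs_setn.
apply: (@halts_mono _ _ _ (3 + n.+1 * (time_bound strip_body + 6).+1)
  _ (fun s => exists q, hung q s)) => //; last by rewrite /=; nia.
apply: halts_seq_run => //; rewrite -/s1.
have inv0 : strip_inv n s1.
  exists q, 0%N; have -> : [set z in take 0 q] = set0 by apply/setP => z; rewrite take0 !inE.
  split=> [|v|v z|v]; first by split.
  - rewrite qE; have [vx|//] := boolP (v != x).
    have [-> _ _] := arr v; rewrite residual_one vx setD0 subset0 -cards_eq0.
    by case: #|_|.
  - rewrite qE => /andP[vx]; have [-> _ _] := arr v; rewrite residual_one vx setD0.
    rewrite add1n eqSS cards_eq0 => /eqP ->; by rewrite in_set0.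
  have [] := arr v; rewrite /collected setI0 big_set0 addn0; split=> //.
apply: (halts_while (Inv := strip_inv) inv0).
  move=> j s u inv /=; rewrite -ltnNge => lt.
  have is_ : inputs I s by apply: inputs_unchanged u in1.
  by have [j' jj' inv'] := strip_step is_ inv lt; exists j' => //; apply: halts_run.
move=> j s u [q' [k [[kj kQH kq [QT Qq] uq'] ready order arr']]] /=.
rewrite negbK kQH QT => qk; have {}qk : k = size q' by lia.
move: ready arr'; rewrite qk take_size => ready arr'.
have all v : v != x -> v \in [set z in q'].
  apply: (children_closed root) => {}v vx sub.
  by rewrite in_set ready vx.
have childrenW v : children x par v \subset [set z in q'].
  by apply/subsetP => z /childrenP [zx _]; apply: all.
exists q'; split.
- by split.
- by split=> // v; rewrite ready childrenW andbT.
- move=> z zx pzx; apply: order; last exact: child_par.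
  by have := all _ pzx; rewrite in_set.
- move=> v vx; have [_ -> ->] := arr' v; rewrite residual_leaf //.
  by rewrite (collected_full tree root).
by rewrite u.1.
Qed.

End HangProgram.

(** * Testing a threshold *)

Local Notation aONP := 21%N (only parsing).
Local Notation vOK := 22%N (only parsing).
Local Notation vTR := 23%N (only parsing).
Local Notation rX := 4%N (only parsing).
Local Notation rD := 7%N (only parsing).
Local Notation rC := 8%N (only parsing).
Local Notation rL := 9%N (only parsing).

Definition hang_time (rt : nexp) (sel : nexp -> bexp) : nat :=
  time_bound (clear_body sel) + time_bound degree_body +
  time_bound (push_if_leaf rt (nvar vI)) + time_bound (strip_body rt) + 80.

(** A parent edge is in the trunk when all the counted vertices are below it. *)
Definition set_trunk : cmd :=
  If (BNEq (NGet aCNT (nvar vV)) (nvar vTOT))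
    (nassign vTR (NConst 1)) (nassign vTR (NConst 0)).

Definition mark_body : cmd :=
  nassign vV (NGet aQ (nvar vI));; load_edge;; set_trunk;;
  NSet aONP (nvar vE) (nvar vTR).
Definition mark_prog : cmd := for_loop vI (nvar vQT) mark_body.

(** Computes [best_change]; the disjunction singles out the cases in which [cap] is
    the bound. *)
Definition set_change : cmd :=
  If (BAnd (BRLe (RGet 3 (nvar vE)) (RGet rC (NConst 0)))
        (BNEq (nvar vTR) (NGet aONP (nvar vE))))
    (If (BOr (BNEq (NGet aONP (nvar vE)) (NConst 1))
          (BRLe (RGet 2 (nvar vE)) (RGet 1 (nvar vE))))
      (RSet rX (nvar vE) (RGet 2 (nvar vE)))
      (RSet rX (nvar vE) (RGet 1 (nvar vE))))
    (RSet rX (nvar vE) (RConst 0)).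
Definition set_new_len : cmd :=
  If (BNEq (NGet aONP (nvar vE)) (NConst 1))
    (rassign rL (RAdd (RGet 1 (nvar vE)) (RGet rX (nvar vE))))
    (rassign rL (RSub (RGet 1 (nvar vE)) (RGet rX (nvar vE)))).
Definition set_depth : cmd :=
  If (BNEq (nvar vTR) (NConst 1))
    (RSet rD (nvar vV) (RSub (RGet rD (nvar vU)) (RGet rL (NConst 0))))
    (RSet rD (nvar vV) (RAdd (RGet rD (nvar vU)) (RGet rL (NConst 0)))).
Definition check_depth : cmd :=
  If (BRLe (RGet rD (nvar vV)) (RConst 0)) Skip (nassign vOK (NConst 0)).

(** Extends the signed length of the path from the parent of [vV] to [vV]. *)
Definition descend_body : cmd :=
  nassign vV (NGet aQ (NSub (NSub (nvar vQT) (NConst 1)) (nvar vI)));;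
  load_edge;; set_trunk;; set_change;; set_new_len;; set_depth;; check_depth.
Definition descend_prog (rt : nexp) : cmd :=
  (nassign vOK (NConst 1);; RSet rD rt (RConst 0));;
  for_loop vI (nvar vQT) descend_body.

Definition root_test_prog (rt : nexp) (sel : nexp -> bexp) : cmd :=
  hang_prog rt sel;; descend_prog rt.
Definition root_test_time (rt : nexp) (sel : nexp -> bexp) : nat :=
  hang_time rt sel + time_bound descend_body + ncost rt + 30.

Section Test.
Variable R : realFieldType.
Variables (n m : nat) (I : instance R 'I_n 'I_m).
Hypothesis valI : valid I.
Let tree := valid_tree valI.
Local Notation a := (leaf_a I).
Local Notation b := (leaf_b I).
Local Notation P := (path_set (ends I)).

Lemma edge_exists : exists e : 'I_m, true.
Proof.
have : leaf (ends I) a by apply: valid_leaf_a.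
case/cards1P => u ua; have : u \in [set u] by rewrite set11.
by rewrite -ua in_set => /existsP [e _]; exists e.
Qed.

Lemma edges_vertices : m.+1 = n.
Proof.
have [e _] := edge_exists; have [par [pe root]] := rooted_exists tree a e.
by have := card_edges tree root; rewrite !card_ord.
Qed.

Section Root.
Variables (rt : nexp) (sel : nexp -> bexp).
Variables (x : 'I_n) (S : {set 'I_n}).
Hypothesis rtE : forall s, inputs I s -> neval s rt = x.
Hypothesis selE : forall s i (v : 'I_n), inputs I s -> neval s i = v ->
  beval s (sel i) = (v \in S).

Section Hung.
Variables (par : 'I_n -> 'I_n) (pe : 'I_n -> 'I_m).
Hypothesis root : rooted (ends I) x par pe.

Lemma hang_halts s0 : inputs I s0 ->
  halts (hang_prog rt sel) s0 (n.+1 * hang_time rt sel) (fun s =>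
    inputs I s /\ exists q, hung I x S par pe q s).
Proof.
move=> in0; pose T0 := (n.+1 * (time_bound (clear_body sel) + 20) +
  (m.+1 * (time_bound degree_body + 20) +
   (n.+1 * (time_bound (push_if_leaf rt (nvar vI)) + 20) +
    n.+1 * (time_bound (strip_body rt) + 20))))%N.
apply: (@halts_mono _ _ _ T0 _ (fun s => inputs I s /\ exists q, hung I x S par pe q s)) => //.
  apply: halts_seq; first exact/halts_unchanged/(clear_halts selE).
  move=> s1 [[deg0 sm0 cnt1 tot1] u1].
  have in1 : inputs I s1 by apply: inputs_unchanged u1 in0.
  apply: halts_seq; first exact/halts_unchanged/(degree_halts valI root).
  move=> s2 [arr2 u2].
  have in2 : inputs I s2 by apply: inputs_unchanged u2 in1.
  apply: halts_seq; first exact/halts_unchanged/(queue_halts rtE).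
  move=> s3 [[q [st3 uq qE]] u3].
  have in3 : inputs I s3 by apply: inputs_unchanged u3 in2.
  apply: (halts_mono (T := (n.+1 * (time_bound (strip_body rt) + 20))%N)) => //.
    apply/halts_unchanged/(strip_halts valI root rtE (S := S) (q := q)) => //.
    - by move=> v; rewrite qE andbC u3.1.
    - by move=> v; have [h1 h2] := arr2 v; rewrite !u3.1 // h1 h2 u2.1.
    by rewrite u3.1 // u2.1.
  by move=> s4 [h u4]; split=> //; apply: inputs_unchanged u4 in3.
by rewrite /T0 /hang_time edges_vertices !mulnDr; lia.
Qed.

Variables (q : seq 'I_n).

Lemma run_set_trunk s (v : 'I_n) : v != x -> hung I x S par pe q s ->
  nmem s vV 0 = v ->
  nmem (run set_trunk s) vTR 0 = (pe v \in trunk (ends I) x S).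
Proof.
move=> vx [_ _ _ /(_ v vx) [_ cnt] tot] sv.
rewrite /= sv cnt tot -eqn_leq mem_trunk_below //.
by case: ifP; rewrite /= /upd.
Qed.

Lemma hung_unchanged c s s' : all (fun i => i \notin nwrites c) [:: aSM; aCNT; vTOT; aQ; vQT] ->
  unchanged c s s' -> hung I x S par pe q s -> hung I x S par pe q s'.
Proof.
move=> /= /and5P[h1 h2 h3 h4 /andP[h5 _]] [u _] [[st1 st2] h7 h8 h9 h10].
split=> //; last by rewrite u.
  by split=> [|i iq]; rewrite u // st2.
by move=> v /h9 [? ?]; rewrite !u.
Qed.

Lemma hung_size s : hung I x S par pe q s -> size q = m.
Proof.
case=> _ [uq qE] _ _ _; apply: succn_inj; rewrite edges_vertices -(card_uniqP uq).
have := cardC (pred1 x); rewrite card1 card_ord add1n => h; apply: etrans h; congr _.+1.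
by apply: eq_card => v; rewrite qE.
Qed.


(** A vertex is treated only after its parent: the queue is read from its end. *)
Lemma nth_last_par s k (v := nth x q (m - 1 - k)) :
  hung I x S par pe q s -> (k < m)%N ->
  [/\ v \in q, v != x, index v q = (m - 1 - k)%N
    & par v = x \/ (m <= index (par v) q + k)%N].
Proof.
move=> hq km; have qm := hung_size hq; case: hq => _ [uq qE] order _ _.
have iq : (m - 1 - k < size q)%N by lia.
have vq : v \in q by apply: mem_nth.
have vx : v != x by rewrite -qE.
have iv : index v q = (m - 1 - k)%N by rewrite index_uniq.
split=> //; have [|px] := eqVneq (par v) x; first by left.
by right; have := order v vx px; rewrite iv; lia.
Qed.

Definition marked (s : state R) : Prop :=
  forall e : 'I_m, nmem s aONP e = (e \in P a b).

Lemma run_set_change s (e : 'I_m) : inputs I s -> marked s ->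
  nmem s vE 0 = e -> nmem s vTR 0 = (e \in trunk (ends I) x S) ->
  forall f : 'I_m, rmem (run set_change s) rX f =
    if f == e then best_change I (rmem s rC 0) x S e else rmem s rX f.
Proof.
move=> is_ mk sE sT f; rewrite /= sE sT (in_ucost is_) mk -eqn_leq.
rewrite (in_bound is_) (in_len is_).
rewrite /best_change /cap; case: (ucost I e <= _)%R => /=; last first.
  by rewrite /upd /= ?sE (inj_eq val_inj).
have -> : (((e \in trunk (ends I) x S) : nat) == (e \in P a b)) =
    ((e \in trunk (ends I) x S) == (e \in P a b)).
  by case: (_ \in _); case: (_ \in _).
case: (_ == _); last by rewrite /= /upd /= ?sE (inj_eq val_inj).
case: (e \in P a b) => /=; first by rewrite /upd /= ?sE ?(in_bound is_) (inj_eq val_inj).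
rewrite /Num.min; case: ltgtP => /= h; rewrite /upd /= ?sE ?(in_bound is_) ?(in_len is_) (inj_eq val_inj) //.
by rewrite h.
Qed.

Lemma run_set_new_len s (e : 'I_m) (X : 'I_m -> R) : inputs I s -> marked s ->
  nmem s vE 0 = e -> rmem s rX e = X e ->
  rmem (run set_new_len s) rL 0 = new_len I X e.
Proof.
move=> is_ mk sE sX; rewrite /= sE mk /new_len.
by case: (e \in P a b); rewrite /= /upd /= ?sX ?(in_len is_).
Qed.

Definition descend_sum (l : 'I_m -> R) (v : 'I_n) : R :=
  (\sum_(e in P x v) signed_len (ends I) l x S e)%R.

Lemma descend_sum_par l v : v != x -> descend_sum l v =
  (descend_sum l (par v) + signed_len (ends I) l x S (pe v))%R.
Proof.
move=> vx; rewrite /descend_sum (rooted_path root vx) big_setU1 ?(rooted_fresh root vx) //=.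
by rewrite GRing.addrC.
Qed.

Lemma run_set_depth s (v u : 'I_n) e (l : 'I_m -> R) d :
  nmem s vV 0 = v -> nmem s vU 0 = u -> nmem s vTR 0 = (e \in trunk (ends I) x S) ->
  rmem s rL 0 = l e -> rmem s rD u = d ->
  forall w : 'I_n, rmem (run set_depth s) rD w =
    if w == v then (d + signed_len (ends I) l x S e)%R else rmem s rD w.
Proof.
move=> sV sU sT sL sD w; rewrite /= sT /signed_len.
by case: (e \in trunk _ _ _); rewrite /= /upd /= sV sU sL sD (inj_eq val_inj).
Qed.

Definition descend_inv (l X : 'I_m -> R) (k : nat) (s : state R) : Prop :=
  let done v := (v != x) && (m <= index v q + k)%N in
  [/\ rmem s rD x = 0%R,
      forall v : 'I_n, done v -> rmem s rD v = descend_sum l v,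
      forall v : 'I_n, done v -> rmem s rX (pe v) = X (pe v)
    & nmem s vOK 0 = [forall v, done v ==> (descend_sum l v <= 0)%R]].

Lemma descend_step s k (X := best_change I (rmem s rC 0) x S) (l := new_len I X) :
  inputs I s -> hung I x S par pe q s -> marked s -> (k < m)%N -> nmem s vI 0 = k ->
  descend_inv l X k s -> descend_inv l X k.+1 (run descend_body s).
Proof.
move=> is_ hq mk km kI [D0 Dd Xd OKd].
have qm := hung_size hq; have := nth_last_par hq km.
set v := nth x q _; case=> vq vx iv pv.
have vn (w : 'I_n) : (w != x) && (m <= index w q + k.+1)%N =
    (w == v) || (w != x) && (m <= index w q + k)%N.
  have [->|wv] := eqVneq w v; first by rewrite vx iv; lia.
  have [//|wx /=] := eqVneq w x; apply/idP/idP => h; last by lia.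
  have : index w q != index v q.
    apply: contra wv => /eqP wv; case: hq => _ [_ qE] _ _ _.
    by rewrite -(nth_index x vq) -wv nth_index // qE.
  by rewrite iv; lia.
change (descend_inv l X k.+1 (run check_depth (run set_depth (run set_new_len
  (run set_change (run set_trunk (run load_edge
   (run (nassign vV (NGet aQ (NSub (NSub (nvar vQT) (NConst 1)) (nvar vI)))) s)))))))).
set pop := nassign vV _.
have s1V : nmem (run pop s) vV 0 = v.
  by rewrite /= /upd /= kI; case: hq => -[-> Qq] _ _ _ _; rewrite qm Qq //; lia.
have is1 : inputs I (run pop s) by apply: inputs_setn.
have us1 : unchanged pop s (run pop s) by apply: unchanged_run.
have hq1 : hung I x S par pe q (run pop s).
  by apply: hung_unchanged us1 hq.
move: (run pop s) => s1 in s1V is1 us1 hq1 *.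
have smv : nmem s1 aSM v = pe v by case: hq1 => _ _ _ /(_ v vx) [].
have [s2E s2U] := run_load_edge root is1 s1V vx smv.
have us2 : unchanged load_edge s1 (run load_edge s1) by apply: unchanged_run.
move: (run load_edge s1) => s2 in s2E s2U us2 *.
have hq2 : hung I x S par pe q s2 by apply: hung_unchanged us2 hq1.
have s2V : nmem s2 vV 0 = v by rewrite us2.1.
have s3T := run_set_trunk vx hq2 s2V.
have us3 : unchanged set_trunk s2 (run set_trunk s2) by apply: unchanged_run.
move: (run set_trunk s2) => s3 in s3T us3 *.
have is3 : inputs I s3.
  by apply: inputs_unchanged us3 _ => //; apply: inputs_unchanged us2 is1.
have s3V : nmem s3 vV 0 = v by rewrite us3.1.
have s3E : nmem s3 vE 0 = pe v by rewrite us3.1.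
have s3U : nmem s3 vU 0 = par v by rewrite us3.1.
have mk3 : marked s3 by move=> e; rewrite us3.1 // us2.1 // us1.1.
have C3 : rmem s3 rC 0 = rmem s rC 0 by rewrite us3.2 // us2.2 // us1.2.
have s4X := run_set_change is3 mk3 s3E s3T; rewrite C3 -/X in s4X.
have us4 : unchanged set_change s3 (run set_change s3) by apply: unchanged_run.
move: (run set_change s3) => s4 in s4X us4 *.
have is4 : inputs I s4 by apply: inputs_unchanged us4 is3.
have mk4 : marked s4 by move=> e; rewrite us4.1.
have s4E : nmem s4 vE 0 = pe v by rewrite us4.1.
have s4Xe : rmem s4 rX (pe v) = X (pe v) by rewrite s4X eqxx.
have s5L := run_set_new_len is4 mk4 s4E s4Xe; rewrite -/l in s5L.
have us5 : unchanged set_new_len s4 (run set_new_len s4) by apply: unchanged_run.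
move: (run set_new_len s4) => s5 in s5L us5 *.
have Ds (w : 'I_n) : rmem s5 rD w = rmem s rD w.
  by rewrite us5.2 // us4.2 // us3.2 // us2.2 // us1.2.
have s5D : rmem s5 rD (par v) = descend_sum l (par v).
  rewrite Ds; have [px|px] := eqVneq (par v) x.
    by rewrite px D0 /descend_sum path_set_xx // big_set0.
  by rewrite Dd // px /=; case: pv => // h; rewrite h eqxx in px.
have s5V : nmem s5 vV 0 = v by rewrite us5.1 // us4.1.
have s5U : nmem s5 vU 0 = par v by rewrite us5.1 // us4.1.
have s5T : nmem s5 vTR 0 = (pe v \in trunk (ends I) x S) by rewrite us5.1 // us4.1.
have s6D := run_set_depth s5V s5U s5T s5L s5D; rewrite -descend_sum_par // in s6D.
have us6 : unchanged set_depth s5 (run set_depth s5) by apply: unchanged_run.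
move: (run set_depth s5) => s6 in s6D us6 *.
have s6V : nmem s6 vV 0 = v by rewrite us6.1.
have s6OK : nmem s6 vOK 0 = nmem s vOK 0.
  by rewrite us6.1 // us5.1 // us4.1 // us3.1 // us2.1 // us1.1.
have us7 : unchanged check_depth s6 (run check_depth s6) by apply: unchanged_run.
split.
- by rewrite us7.2 // s6D eq_sym (negPf vx) Ds D0.
- move=> w; rewrite vn us7.2 // s6D; case: eqP => [->//|_ /= wd].
  by rewrite Ds Dd.
- move=> w; rewrite vn us7.2 // us6.2 // us5.2 // s4X => wd.
  case: eqP => [->//|wv]; have wv' : w != v by apply/eqP => wv'; rewrite wv' in wv.
  rewrite (negPf wv') /= in wd.
  by rewrite us3.2 // us2.2 // us1.2 // Xd.
have -> : [forall w, (w != x) && (m <= index w q + k.+1)%N ==> (descend_sum l w <= 0)%R] =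
    (descend_sum l v <= 0)%R && [forall w, (w != x) && (m <= index w q + k)%N ==> (descend_sum l w <= 0)%R].
  apply/forallP/andP => [h|[h1 /forallP h2] w].
    split; first by have := h v; rewrite vn eqxx.
    by apply/forallP => w; apply/implyP => wd; have := h w; rewrite vn wd orbT.
  by rewrite vn; case: eqP => [->//|_] /=; apply: h2.
rewrite /= s6V s6D eqxx; case: ifP => h /=; first by rewrite s6OK.
by rewrite /upd.
Qed.

Lemma descend_halts s0 (X := best_change I (rmem s0 rC 0) x S) :
  inputs I s0 -> hung I x S par pe q s0 -> marked s0 ->
  halts (descend_prog rt) s0 (n.+1 * (time_bound descend_body + ncost rt + 30)) (fun s =>
    nmem s vOK 0 = test_root I (rmem s0 rC 0) x S /\
    forall e : 'I_m, rmem s rX e = X e).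
Proof.
move=> in0 hq mk; have qm := hung_size hq.
pose l := new_len I X.
set start := (nassign vOK (NConst 1);; RSet rD rt (RConst 0)).
have us1 : unchanged start s0 (run start s0) by apply: unchanged_run.
have s1OK : nmem (run start s0) vOK 0 = 1%N by rewrite /= /upd.
have s1D : rmem (run start s0) rD x = 0%R.
  by rewrite /= (rtE (s := setn s0 vOK 0 1)) ?/upd ?eqxx //; apply: inputs_setn.
apply: (@halts_mono _ _ _ (time_bound start + m.+1 * (time_bound descend_body + ncost (nvar vQT) + 14))
  _ (descend_inv l X m)); last 2 first.
- have := edges_vertices; rewrite /= => <-.
  rewrite -[ncost rt + 1]/(ncost rt + 1)%N.
  by nia.
- move=> s [_ _ Xd ->].
  have done v : (v != x) && (m <= index v q + m)%N = (v != x) by rewrite leq_addl andbT.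
  split=> [|e]; last first.
    by have [v vx <-] := pe_surj tree root e; rewrite Xd // done.
  congr nat_of_bool; apply/forallP/forallP => h v; last by rewrite (h v) implybT.
  have [->|vx] := eqVneq v x; first by rewrite path_set_xx // big_set0.
  by have := h v; rewrite done vx.
apply: halts_seq_run => //.
move: (run start s0) => s1 in us1 s1OK s1D *.
have in1 : inputs I s1 by apply: inputs_unchanged us1 in0.
apply: (halts_for (J := descend_inv l X)) => //=.
- by move=> s u; rewrite u.1 // us1.1 //; case: hq => -[-> _].
- have none (v : 'I_n) : (v != x) && (m <= index v q + 0)%N = false.
    apply/negP => /andP[vx]; have : (index v q < size q)%N.
      by rewrite index_mem; case: hq => _ [_ ->] _ _ _.
    by rewrite qm; lia.
  split=> [|v|v|]; rewrite ?none //= /upd /= s1OK.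
  suff -> : [forall v, (v != x) && (m <= index v q + 0)%N ==> (descend_sum l v <= 0)%R] by [].
  by apply/forallP => v; rewrite none.
move=> k s u km kI inv.
have u0 : unchanged (descend_prog rt) s0 s.
  apply: unchanged_trans (_ : unchanged _ s1 s).
    by apply: unchanged_sub us1 => i; rewrite /= !inE => h; rewrite ?h ?orbT //; case/orP: h => ->; rewrite ?orbT.
  by apply: unchanged_sub u => i; rewrite /= !inE => h; rewrite h ?orbT.
have C0 : rmem s rC 0 = rmem s0 rC 0 by rewrite u0.2.
apply: halts_run => //.
have step := @descend_step s k; rewrite C0 in step; apply: step => //.
- by apply: inputs_unchanged u0 in0.
- by apply: hung_unchanged u0 hq.
- by move=> e; rewrite u0.1.
Qed.

Lemma mark_halts s0 : inputs I s0 -> hung I x S par pe q s0 ->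
  halts mark_prog s0 (n.+1 * (time_bound mark_body + 20)) (fun s =>
    forall e : 'I_m, nmem s aONP e = (e \in trunk (ends I) x S)).
Proof.
move=> in0 hq; have qm := hung_size hq.
pose J k (s : state R) := forall v, v \in take k q ->
  nmem s aONP (pe v) = (pe v \in trunk (ends I) x S).
apply: (@halts_mono _ _ _ (m.+1 * (time_bound mark_body + ncost (nvar vQT) + 14)) _ (J m)); last 2 first.
- by have := edges_vertices; rewrite [ncost _]/= => <-; nia.
- move=> s hs e; have [v vx <-] := pe_surj tree root e; apply: hs.
  by rewrite -qm take_size; case: hq => _ [_ ->].
apply: (halts_for (J := J)) => //=.
- by move=> s u; rewrite u.1 //; case: hq => -[-> _].
- by move=> v; rewrite take0.
move=> k s u km kI Jk; apply: halts_run => //.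
have is_ : inputs I s by apply: inputs_unchanged u in0.
have hs : hung I x S par pe q s by apply: hung_unchanged u hq.
have kq : (k < size q)%N by rewrite qm.
pose v := nth x q k; have vq : v \in q by apply: mem_nth.
have vx : v != x by case: hq => _ [_ <-].
suff h w : w \in take k.+1 q -> nmem (run mark_body s) aONP (pe w) = (pe w \in trunk (ends I) x S).
  by move=> w /h.
set pop := nassign vV (NGet aQ (nvar vI)).
change (run mark_body s) with
  (run (NSet aONP (nvar vE) (nvar vTR)) (run set_trunk (run load_edge (run pop s)))).
have s1V : nmem (run pop s) vV 0 = v.
  by rewrite /= /upd /= kI; case: hs => -[_ Qq] _ _ _ _; rewrite Qq.
have us1 : unchanged pop s (run pop s) by apply: unchanged_run.
move: (run pop s) => s1 in s1V us1 *.
have is1 : inputs I s1 by apply: inputs_unchanged us1 is_.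
have hq1 : hung I x S par pe q s1 by apply: hung_unchanged us1 hs.
have smv : nmem s1 aSM v = pe v by case: hq1 => _ _ _ /(_ v vx) [].
have [s2E _] := run_load_edge root is1 s1V vx smv.
have us2 : unchanged load_edge s1 (run load_edge s1) by apply: unchanged_run.
move: (run load_edge s1) => s2 in s2E us2 *.
have hq2 : hung I x S par pe q s2 by apply: hung_unchanged us2 hq1.
have s2V : nmem s2 vV 0 = v by rewrite us2.1.
have s3T := run_set_trunk vx hq2 s2V.
have us3 : unchanged set_trunk s2 (run set_trunk s2) by apply: unchanged_run.
move: (run set_trunk s2) => s3 in s3T us3 *.
have s3E : nmem s3 vE 0 = pe v by rewrite us3.1.
rewrite (take_nth x kq) mem_rcons inE => wk; rewrite /= /upd /= s3E s3T (inj_eq val_inj).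
have [->//|wv] := eqVneq (pe w) (pe v).
have {}wk : w \in take k q by case/orP: wk => // /eqP h; rewrite h eqxx in wv.
by rewrite us3.1 // us2.1 // us1.1 // Jk.
Qed.

End Hung.

(** The root test costs linear time: each vertex is queued once and each edge is
    handled a bounded number of times. *)
Lemma root_test_halts s0 : inputs I s0 -> marked s0 ->
  halts (root_test_prog rt sel) s0 (n.+1 * root_test_time rt sel) (fun s =>
    [/\ inputs I s, marked s, rmem s rC 0 = rmem s0 rC 0,
      nmem s vOK 0 = test_root I (rmem s0 rC 0) x S &
      forall e : 'I_m, rmem s rX e = best_change I (rmem s0 rC 0) x S e]).
Proof.
move=> in0 mk0; have [e0 _] := edge_exists.
have [par [pe root]] := rooted_exists tree x e0.
have h : halts (root_test_prog rt sel) s0 (n.+1 * root_test_time rt sel) (fun s =>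
    nmem s vOK 0 = test_root I (rmem s0 rC 0) x S /\
      forall e : 'I_m, rmem s rX e = best_change I (rmem s0 rC 0) x S e).
  apply: (@halts_mono _ _ _ (n.+1 * hang_time rt sel +
    n.+1 * (time_bound descend_body + ncost rt + 30)) _ (fun s =>
    nmem s vOK 0 = test_root I (rmem s0 rC 0) x S /\
      forall e : 'I_m, rmem s rX e = best_change I (rmem s0 rC 0) x S e)) => //.
    apply: halts_seq; first exact/halts_unchanged/(hang_halts root).
    move=> s1 [[in1 [q hq]] u1].
    have -> : rmem s0 rC 0 = rmem s1 rC 0 by rewrite u1.2.
    apply: (descend_halts root in1 hq) => e; rewrite u1.1 //.
  by rewrite /root_test_time -mulnDr leq_mul2l; lia.
apply: halts_mono (halts_unchanged h) _ _ => // s [[h1 h2] u].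
split=> //; first by apply: inputs_unchanged u in0.
  by move=> e; rewrite u.1.
by rewrite u.2.
Qed.

End Root.
End Test.

Definition sel_heavy (i : nexp) : bexp := BNot (BRLe (RGet 0 i) (RConst 0)).
Definition sel_vertex (r : nexp) (i : nexp) : bexp := BNEq i r.

(** [P a b] is the trunk for [a] and the single vertex [b]. *)
Definition path_prog : cmd := hang_prog in_a (sel_vertex in_b);; mark_prog.

Definition is_ok : bexp := BNLe (NConst 1) (nvar vOK).
Definition test_prog : cmd :=
  root_test_prog in_a sel_heavy;;
  If is_ok Skip
    (root_test_prog in_b sel_heavy;;
     If is_ok Skip
       (root_test_prog in_a (sel_vertex in_b);;
        If is_ok (root_test_prog in_b (sel_vertex in_a)) Skip)).

Definition test_time : nat :=
  root_test_time in_a sel_heavy + root_test_time in_b sel_heavy +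
  root_test_time in_a (sel_vertex in_b) + root_test_time in_b (sel_vertex in_a) + 20.

Section TestProgram.
Variables (R : realFieldType) (n m : nat) (I : instance R 'I_n 'I_m).
Hypothesis valI : valid I.
Local Notation a := (leaf_a I).
Local Notation b := (leaf_b I).

Lemma sel_heavyE s i (v : 'I_n) : inputs I s -> neval s i = v ->
  beval s (sel_heavy i) = (v \in heavy I).
Proof. by move=> is_ iv; rewrite /= iv (in_weight is_) -ltNge in_set. Qed.

Lemma sel_vertexE r (x : 'I_n) (s : state R) i (v : 'I_n) : (forall s, inputs I s -> neval s r = x) ->
  inputs I s -> neval s i = v -> beval s (sel_vertex r i) = (v \in [set x]).
Proof.
by move=> rx is_ iv; rewrite /= iv rx // -eqn_leq (inj_eq val_inj) in_set1.
Qed.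

Lemma path_halts s0 : inputs I s0 ->
  halts path_prog s0 (n.+1 * (hang_time in_a (sel_vertex in_b) + time_bound mark_body + 20))
    (marked I).
Proof.
move=> in0; have [e0 _] := edge_exists valI.
have [par [pe root]] := rooted_exists (valid_tree valI) a e0.
rewrite -addnA mulnDr; apply: halts_seq.
  apply/halts_unchanged/(hang_halts valI _ _ root (S := [set b])) => // [s|s i v].
    exact: in_aE.
  by apply: sel_vertexE => s'; apply: in_bE.
move=> s1 [[in1 [q hq]] u1].
apply: halts_mono (mark_halts valI root in1 hq) _ _ => // s hs e.
rewrite hs; congr nat_of_bool; apply/trunkP/idP => [|h v]; first by apply; apply: set11.
by rewrite in_set1 => /eqP ->.
Qed.

(** Each root test overwrites the output array, which is therefore left with the
    change of the last test performed: that of [solution] if the test succeeds. *)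
Lemma test_halts s0 (c := rmem s0 rC 0) : inputs I s0 -> marked I s0 ->
  halts test_prog s0 (n.+1 * test_time) (fun s =>
    nmem s vOK 0 = test I c /\
    (test I c -> forall e : 'I_m, rmem s rX e = solution I c e)).
Proof.
move=> in0 mk0.
have aE := fun s => @in_aE R n m I s; have bE := fun s => @in_bE R n m I s.
pose T0 := (n.+1 * root_test_time in_a sel_heavy + (4 +
  (n.+1 * root_test_time in_b sel_heavy + (4 +
  (n.+1 * root_test_time in_a (sel_vertex in_b) + (4 +
   n.+1 * root_test_time in_b (sel_vertex in_a)).+1)).+1)).+1)%N.
pose Q s := nmem s vOK 0 = test I c /\
    (test I c -> forall e : 'I_m, rmem s rX e = solution I c e).
apply: (@halts_mono _ _ _ T0 _ Q) => //; last by rewrite /T0 /test_time !mulnDr; lia.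
have branch s (ok : bool) c1 c2 T : nmem s vOK 0 = ok ->
    (ok -> halts c1 s T Q) -> (~~ ok -> halts c2 s T Q) ->
    halts (If is_ok c1 c2) s (4 + T).+1 Q.
  by move=> sok h1 h2; apply: halts_if; rewrite /= sok; case: ok {sok} h1 h2 => h1 h2; [apply: h1|apply: h2].
have skip s T : (0 < T)%N -> Q s -> halts Skip s T Q.
  by move=> T0' hQ; apply: (halts_mono (T := 1%N)) (halts_run (c := Skip) isT hQ) _ _.
have pos rt sel : (0 < n.+1 * root_test_time rt sel)%N by rewrite muln_gt0 /root_test_time; lia.
apply: halts_seq; first exact: (root_test_halts valI (rt := in_a) aE sel_heavyE in0 mk0).
move=> s1 [in1 mk1 C1 ok1 X1]; rewrite -/c in C1 ok1 X1.
apply: (branch _ _ _ _ _ ok1) => [t1|nok1].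
  apply: skip; first by rewrite addn_gt0 pos.
  by split=> [|_ e]; rewrite ?ok1 ?X1 /test /solution t1.
apply: halts_seq; first exact: (root_test_halts valI (rt := in_b) bE sel_heavyE in1 mk1).
move=> s2 [in2 mk2 C2 ok2 X2]; rewrite C1 in C2 ok2 X2.
apply: (branch _ _ _ _ _ ok2) => [t2|nok2].
  apply: skip; first by rewrite addn_gt0 pos.
  by split=> [|_ e]; rewrite ?ok2 ?X2 /test /solution t2 (negPf nok1).
apply: halts_seq; first exact: (root_test_halts valI (rt := in_a) (sel := sel_vertex in_b) aE
  (fun s i v => @sel_vertexE in_b b s i v bE) in2 mk2).
move=> s3 [in3 mk3 C3 ok3 X3]; rewrite C2 in C3 ok3 X3.
apply: (branch _ _ _ _ _ ok3) => [t3|nok3]; last first.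
  apply: skip => //; by split=> [|]; rewrite ?ok3 /test (negPf nok1) (negPf nok2) (negPf nok3).
apply: halts_mono (root_test_halts valI (rt := in_b) (sel := sel_vertex in_a) bE
  (fun s i v => @sel_vertexE in_a a s i v aE) in3 mk3) _ _ => // s4 [_ _ _]; rewrite C3 => ok4 X4.
split=> [|_ e]; last by rewrite X4 /solution (negPf nok1) (negPf nok2).
rewrite ok4; congr nat_of_bool; apply/idP/or3P => [t4|].
  by constructor 3; apply/andP; exact: conj t3 t4.
by case=> [t|t|/andP[_ t]]; [case/negP: nok1|case/negP: nok2|exact: t].
Qed.

End TestProgram.

(** * Sorting the thresholds *)

Local Notation vW := 30%N (only parsing).
Local Notation vLO := 31%N (only parsing).
Local Notation vMID := 32%N (only parsing).
Local Notation vJ := 33%N (only parsing).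
Local Notation vHI := 34%N (only parsing).
Local Notation rA := 5%N (only parsing).
Local Notation rB := 6%N (only parsing).

Section Merging.
Variables (R : realFieldType) (N w : nat) (A : nat -> R).
Implicit Types B : nat -> R.

Definition blocks_sorted (v : nat) (f : nat -> R) : Prop :=
  forall t i j, (t * v <= i)%N -> (i <= j)%N -> (j < t.+1 * v)%N -> (j < N)%N ->
    (f i <= f j)%R.

(** The state of a merging pass that has filled the cells of [B] below [k]: the
    blocks of size [2 * w] before the [t]th are finished, and the two runs of
    that block are consumed up to [lo] and [j]. *)
Record merging (t k lo j : nat) (B : nat -> R) : Prop := Merging {
  merging_lo : (t * (w + w) <= lo <= t * (w + w) + w)%N;
  merging_j : (t * (w + w) + w <= j <= t * (w + w) + w + w)%N;
  merging_jN : (j <= maxn N (t * (w + w) + w))%N;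
  merging_k : (k + (t * (w + w) + w) = lo + j)%N;
  merging_done : forall t' i i', (t' < t)%N -> (t' * (w + w) <= i)%N ->
    (i <= i')%N -> (i' < t'.+1 * (w + w))%N -> (B i <= B i')%R;
  merging_sorted : forall i i', (t * (w + w) <= i)%N -> (i <= i')%N -> (i' < k)%N ->
    (B i <= B i')%R;
  merging_below : forall i i', (t * (w + w) <= i < k)%N -> (i' < N)%N ->
    (lo <= i' < t * (w + w) + w)%N || (j <= i' < t * (w + w) + w + w)%N ->
    (B i <= A i')%R;
  merging_in : forall i, (i < N)%N ->
    [|| i < t * (w + w), t * (w + w) <= i < lo | t * (w + w) + w <= i < j]%N ->
    exists2 i', (i' < k)%N & B i' = A i;
  merging_from : forall i, (i < k)%N -> exists2 i', (i' < N)%N & B i = A i'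
}.

Lemma merging_start B : merging 0 0 0 w B.
Proof. by split=> // *; lia. Qed.

(** At the end of a block both runs are used up, so the block is finished and the
    next one can begin. *)
Lemma merging_next t k lo j B : (t * (w + w) + w + w <= k)%N ->
  merging t k lo j B -> merging t.+1 k k (k + w) B.
Proof.
have tS : (t.+1 * (w + w) = t * (w + w) + w + w)%N by rewrite mulSn; lia.
move=> kt [lo1 j1 jN k1 done srt below incl from].
split; rewrite ?tS; try lia.
- move=> t' i i'; rewrite ltnS leq_eqVlt => /orP[/eqP ->|]; last exact: done.
  by rewrite tS => h1 h2 h3; apply: srt; lia.
- by move=> i iN h; apply: incl => //; lia.
exact: from.
Qed.

(** The cell [k] receives the smaller head of the two runs, hence the least value
    that is left in the block. *)
Lemma merging_step t k lo j B B' (left : bool) :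
  blocks_sorted w A -> (k < N)%N -> (k < t * (w + w) + w + w)%N ->
  left = (lo < t * (w + w) + w)%N &&
    [|| N <= j, t * (w + w) + w + w <= j | (A lo <= A j)%R]%N ->
  (forall i, B' i = if i == k then A (if left then lo else j) else B i) ->
  merging t k lo j B -> merging t k.+1 (lo + left) (j + ~~ left) B'.
Proof.
move=> As kN kt leftE B'E [lo1 j1 jN k1 done srt below incl from].
set t0 := (t * (w + w))%N in As lo1 j1 jN k1 done srt below incl kt leftE *.
have tw : ((t + t) * w = t0)%N by rewrite /t0 mulnDl mulnDr.
(* The two runs of block [t] are the blocks [2 t] and [2 t + 1] of size [w]. *)
have run1 i i' : (t0 <= i)%N -> (i <= i')%N -> (i' < t0 + w)%N -> (i' < N)%N -> (A i <= A i')%R.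
  by move=> h1 h2 h3 h4; apply: (As (t + t)%N); rewrite ?mulSn ?tw //; lia.
have run2 i i' : (t0 + w <= i)%N -> (i <= i')%N -> (i' < t0 + w + w)%N -> (i' < N)%N -> (A i <= A i')%R.
  by move=> h1 h2 h3 h4; apply: (As (t + t).+1); rewrite ?mulSn ?tw //; lia.
have pick : (if left then lo < t0 + w else j < t0 + w + w)%N && ((if left then lo else j) < N)%N.
  by case: left leftE {B'E} => leftE; lia.
have least i' : (i' < N)%N -> (lo <= i' < t0 + w)%N || (j <= i' < t0 + w + w)%N ->
    (A (if left then lo else j) <= A i')%R.
  move=> i'N; case: left leftE pick {B'E} => [/esym /andP[l1 l2]|l1] /andP[p1 p2] /orP[] /andP[h1 h2].
  - by apply: run1 => //; lia.
  - apply: (@le_trans _ _ (A j)); last by apply: run2 => //; lia.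
    by case/or3P: l2 => //; lia.
  - move/esym/negbT: l1; rewrite negb_and => /orP[|]; first by lia.
    rewrite !negb_or -ltNge => /and3P[l1 l2 /ltW l3].
    by apply: le_trans l3 _; apply: run1 => //; lia.
  - by apply: run2 => //; lia.
have old i : (i < k)%N -> B' i = B i by rewrite B'E => ik; rewrite ltn_eqF.
split=> //.
- by case: left leftE pick {B'E least} => leftE pick /=; lia.
- by case: left leftE pick {B'E least} => leftE pick /=; lia.
- by case: left leftE pick {B'E least} => leftE pick /=; lia.
- by case: left leftE pick {B'E least} => leftE pick /=; lia.
- move=> t' i i' t't h1 h2 h3.
  have : (t'.+1 * (w + w) <= t0)%N by rewrite leq_mul2r t't orbT.
  by move=> h4; rewrite !old; [apply: done h1 h2 h3|lia|lia].
- move=> i i' h1 h2; rewrite ltnS leq_eqVlt => /orP[/eqP i'k|i'k]; last first.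
    by rewrite !old ?srt //; lia.
  rewrite [B' i']B'E i'k eqxx; move: h2; rewrite i'k leq_eqVlt => /orP[/eqP ->|ik].
    by rewrite B'E eqxx.
  rewrite old //; apply: below; first by lia.
    by case/andP: pick.
  by case: left leftE pick {B'E least} => leftE pick /=; lia.
- move=> i i' /andP[h1]; rewrite ltnS leq_eqVlt => ik i'N hi'.
  have hi2 : (lo <= i' < t0 + w)%N || (j <= i' < t0 + w + w)%N.
    by case: left leftE pick {B'E least} hi' => leftE pick /=; lia.
  case/orP: ik => [/eqP ->|ik]; first by rewrite B'E eqxx; apply: least.
  by rewrite old //; apply: below => //; lia.
- move=> i iN hi; have [ik|ik] := eqVneq i (if left then lo else j).
    by exists k => //; rewrite B'E eqxx ik.
  have [|i' i'k <-] := incl i iN.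
    by case: left leftE pick {B'E least} ik hi => leftE pick ik /=; lia.
  by exists i'; [lia|rewrite old].
move=> i; rewrite ltnS leq_eqVlt => /orP[/eqP ->|ik].
  by rewrite B'E eqxx; exists (if left then lo else j) => //; case/andP: pick.
by rewrite old //; apply: from.
Qed.

Lemma merging_end t lo j B : (N <= t * (w + w) + w + w)%N -> merging t N lo j B ->
  [/\ blocks_sorted (w + w) B,
      forall i, (i < N)%N -> exists2 i', (i' < N)%N & B i' = A i
    & forall i, (i < N)%N -> exists2 i', (i' < N)%N & B i = A i'].
Proof.
move=> Nt [lo1 j1 jN k1 done srt below incl from]; split=> //.
  move=> t' i i' h1 h2 h3 h4; have [t't|] := ltnP t' t; first exact: done h1 h2 h3.
  rewrite leq_eqVlt => /orP[/eqP tt'|tt']; first by apply: srt; rewrite // tt'.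
  have : (t.+1 * (w + w) <= t' * (w + w))%N by rewrite leq_mul2r tt' orbT.
  by rewrite mulSn; lia.
by move=> i iN; apply: incl => //; lia.
Qed.

End Merging.

Definition new_block : cmd :=
  If (BNLe (nvar vHI) (nvar vI))
    (nassign vLO (nvar vI);; nassign vMID (NAdd (nvar vI) (nvar vW));;
     nassign vJ (NAdd (nvar vI) (nvar vW));;
     nassign vHI (NAdd (NAdd (nvar vI) (nvar vW)) (nvar vW))) Skip.
Definition take_left_run : bexp :=
  BAnd (BNLt (nvar vLO) (nvar vMID))
    (BOr (BNLe in_n (nvar vJ)) (BOr (BNLe (nvar vHI) (nvar vJ))
      (BRLe (RGet rA (nvar vLO)) (RGet rA (nvar vJ))))).
Definition consume (v : nat) : cmd :=
  RSet rB (nvar vI) (RGet rA (nvar v));; nassign v (NAdd (nvar v) (NConst 1)).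
Definition merge_one : cmd := If take_left_run (consume vLO) (consume vJ).
Definition merge_body : cmd := new_block;; merge_one.
Definition copy_body : cmd := RSet rA (nvar vI) (RGet rB (nvar vI)).
Definition pass_body : cmd :=
  (nassign vHI (NConst 0);; for_loop vI in_n merge_body);;
  for_loop vI in_n copy_body;;
  nassign vW (NAdd (nvar vW) (nvar vW)).
Definition collect_body : cmd := RSet rA (nvar vI) (RGet 3 (nvar vI)).
Definition collect_prog : cmd :=
  for_loop vI in_m collect_body;; RSet rA in_m (RConst 0).
(** Bottom-up merge sort: one pass merges neighbouring sorted blocks of size [vW]
    from [rA] into [rB] and copies the result back.  Only the set of values
    matters, so repetitions in the list are harmless. *)
Definition sort_prog : cmd :=
  (collect_prog;; nassign vW (NConst 1));;
  While (BNLt (nvar vW) in_n) pass_body.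

Definition pass_time : nat := time_bound merge_body + time_bound copy_body + 50.
Definition sort_time : nat := time_bound collect_body + 2 * pass_time + 100.

Section SortProgram.
Variables (R : realFieldType) (n m : nat) (I : instance R 'I_n 'I_m).
Hypothesis valI : valid I.

Lemma merge_halts s0 w (A := rmem s0 rA) : (0 < w)%N -> inputs I s0 ->
  nmem s0 vW 0 = w -> blocks_sorted n w A ->
  halts (nassign vHI (NConst 0);; for_loop vI in_n merge_body) s0
    (n.+1 * (time_bound merge_body + 20)) (fun s => exists t lo j,
      (n <= t * (w + w) + w + w)%N /\ merging n w A t n lo j (rmem s rB)).
Proof.
move=> w0 in0 sW srt.
pose J k (s : state R) := (k = 0%N /\ nmem s vHI 0 = 0%N) \/ exists t lo j,
  [/\ merging n w A t k lo j (rmem s rB),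
      nmem s vLO 0 = lo /\ nmem s vMID 0 = (t * (w + w) + w)%N, nmem s vJ 0 = j
    & nmem s vHI 0 = (t * (w + w) + w + w)%N].
have n0 : (0 < n)%N by case: n (leaf_a I) => // -[].
apply: (@halts_mono _ _ _ (3 + n.+1 * (time_bound merge_body + ncost in_n + 14)) _ (J n)); last 2 first.
- by rewrite [ncost _]/=; nia.
- move=> s [[h _]|[t [lo [j [mg _ _ _]]]]]; first by rewrite h in n0.
  exists t, lo, j; split=> //; case: mg; lia.
apply: halts_seq_run => //.
have us1 := unchanged_run s0 (isT : loop_free (nassign vHI (NConst 0))).
have s1HI : nmem (run (nassign vHI (NConst 0)) s0) vHI 0 = 0%N by [].
move: (run _ s0) => s1 in us1 s1HI *.
have in1 : inputs I s1 by apply: inputs_unchanged us1 in0.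
apply: (halts_for (J := J)) => //=.
- by move=> s u; apply: (in_nE (I := I)); apply: inputs_unchanged u in1.
- by left.
move=> k s u kn kI hJ; apply: halts_run => //.
have is_ : inputs I s by apply: inputs_unchanged u in1.
have sWw : nmem s vW 0 = w by rewrite u.1 // us1.1.
have sA i : rmem s rA i = A i by rewrite u.2 // us1.2.
change (run merge_body s) with (run merge_one (run new_block s)).
have : exists t lo j, [/\ merging n w A t k lo j (rmem (run new_block s) rB),
    (k < t * (w + w) + w + w)%N,
    nmem (run new_block s) vLO 0 = lo /\ nmem (run new_block s) vMID 0 = (t * (w + w) + w)%N,
    nmem (run new_block s) vJ 0 = j
  & nmem (run new_block s) vHI 0 = (t * (w + w) + w + w)%N].
  rewrite /= kI; case: hJ => [[k0 hi0]|[t [lo [j [mg [hlo hmid] hj hhi]]]]].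
    exists 0%N, 0%N, w; rewrite hi0 /= /upd /= kI sWw k0.
    by split=> //; [exact: merging_start|lia].
  rewrite hhi; case: leqP => hk; last by exists t, lo, j.
  exists t.+1, k, (k + w)%N; rewrite /= /upd /= kI sWw.
  have kE : k = (t * (w + w) + w + w)%N.
    by case: mg => *; lia.
  rewrite !mulSn; split; [exact: merging_next mg|lia|split; lia|lia|lia].
have us2 := unchanged_run s (isT : loop_free new_block).
move: (run new_block s) => s2 in us2 *.
case=> t [lo [j [mg kt [hlo hmid] hj hhi]]].
have is2 : inputs I s2 by apply: inputs_unchanged us2 is_.
have kI2 : nmem s2 vI 0 = k by rewrite us2.1.
have s2A i : rmem s2 rA i = A i by rewrite us2.2.
pose left := (lo < t * (w + w) + w)%N &&
    [|| n <= j, t * (w + w) + w + w <= j | (A lo <= A j)%R]%N.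
right; exists t, (lo + left)%N, (j + ~~ left)%N.
have leftE : beval s2 take_left_run = left.
  by rewrite /= hlo hmid hj hhi !s2A (in_nE is2) -ltnNge !negb_and !negbK.
have runE : run merge_one s2 = if left then run (consume vLO) s2 else run (consume vJ) s2.
  by rewrite -leftE.
have B'E i : rmem (run merge_one s2) rB i =
    if i == k then A (if left then lo else j) else rmem s2 rB i.
  by rewrite runE; case: (left); rewrite /= /upd /= kI2 ?hlo ?hj s2A.
have [] : [/\ nmem (run merge_one s2) vLO 0 = (lo + left)%N,
    nmem (run merge_one s2) vMID 0 = (t * (w + w) + w)%N,
    nmem (run merge_one s2) vJ 0 = (j + ~~ left)%N
  & nmem (run merge_one s2) vHI 0 = (t * (w + w) + w + w)%N].
  by rewrite runE; case: (left); rewrite /= /upd /= ?hlo ?hmid ?hj ?hhi ?addn0.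
move: (run merge_one s2) B'E => s3 B'E lo3 mid3 j3 hi3; split=> //.
exact: (merging_step srt kn kt (erefl left) B'E mg).
Qed.

Lemma copy_halts s0 : inputs I s0 ->
  halts (for_loop vI in_n copy_body) s0 (n.+1 * (time_bound copy_body + 20))
    (fun s => forall i, (i < n)%N -> rmem s rA i = rmem s0 rB i).
Proof.
move=> in0; apply: (halts_mono (T := (n.+1 * (time_bound copy_body + ncost in_n + 14))%N)
  (Q := fun s => forall i, (i < n)%N -> rmem s rA i = rmem s0 rB i)) => //; last first.
  by rewrite [ncost _]/=; nia.
apply: (halts_for (J := fun k s => forall i, (i < k)%N -> rmem s rA i = rmem s0 rB i)) => //=.
  by move=> s u; apply: (in_nE (I := I)); apply: inputs_unchanged u in0.
move=> k s u kn kI hk; apply: halts_run => //= i; rewrite /upd /= kI ltnS leq_eqVlt.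
by case: eqP => [->|_] //= ik; [rewrite u.2|apply: hk].
Qed.

Definition candidates (A : nat -> R) : Prop :=
  (forall c, candidate I c -> exists2 i, (i < n)%N & A i = c) /\
  (forall i, (i < n)%N -> (0 <= A i)%R).

(** After [p] passes the blocks have size [2 ^ p]; a pass is made only while this
    is below [n]. *)
Definition sort_inv (j : nat) (s : state R) : Prop :=
  exists p, [/\ (p + j = (trunc_log 2 n).+1)%N, nmem s vW 0 = (2 ^ p)%N,
    blocks_sorted n (2 ^ p) (rmem s rA) & candidates (rmem s rA)].

Lemma pass_halts j s : inputs I s -> sort_inv j s ->
  (nmem s vW 0 < n)%N ->
  exists2 j', j = j'.+1 &
    halts pass_body s (n.+1 * pass_time) (sort_inv j').
Proof.
move=> is_ [p [pj sW srt [cand pos]]]; rewrite sW => pn.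
have n0 : (0 < n)%N by lia.
have plog : (p <= trunc_log 2 n)%N by apply: trunc_log_max => //; apply: ltnW.
exists j.-1; first by lia.
pose T0 := (n.+1 * (time_bound merge_body + 20) + (n.+1 * (time_bound copy_body + 20) + 7))%N.
apply: (halts_mono (T := T0) (Q := sort_inv j.-1)) => //; last first.
  by rewrite /T0 /pass_time !mulnDr; lia.
apply: halts_seq; first exact/halts_unchanged/(merge_halts _ is_ sW srt)/expn_gt0.
move=> s1 [[t [lo [k [nt mg]]]] u1]; have [srt' sub sup] := merging_end nt mg.
have in1 : inputs I s1 by apply: inputs_unchanged u1 is_.
apply: halts_seq; first exact/halts_unchanged/(copy_halts in1).
move=> s2 [s2A u2]; apply: (halts_run (c := nassign vW (NAdd (nvar vW) (nvar vW)))) => //.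
have s2W : nmem s2 vW 0 = (2 ^ p)%N by rewrite u2.1 // u1.1.
exists p.+1; split; first by lia.
- by rewrite /= /upd /= s2W expnS mul2n addnn.
- move=> t' i i' h1 h2 h3 h4; rewrite /= !s2A //; last by lia.
  by rewrite expnS mul2n -addnn in h1 h3; apply: srt' h1 h2 h3 h4.
split=> [c /cand [i /sub [i' i'n <-] <-]|i iN].
  by exists i' => //=; rewrite s2A.
by rewrite /= s2A //; have [i' i'n ->] := sup i iN; apply: pos.
Qed.

Lemma collect_halts s0 : inputs I s0 ->
  halts collect_prog s0 (n.+1 * (time_bound collect_body + 30))
    (fun s => candidates (rmem s rA)).
Proof.
move=> in0; have mn := edges_vertices valI.
pose J k (s : state R) := forall e : 'I_m, (e < k)%N -> rmem s rA e = ucost I e.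
pose T0 := (m.+1 * (time_bound collect_body + ncost in_m + 14) + 10)%N.
apply: (halts_mono (T := T0) (Q := fun s => candidates (rmem s rA))) => //; last first.
  by rewrite /T0 mn [ncost _]/=; nia.
apply: (halts_seq (Q1 := fun s => J m s /\ inputs I s)).
  apply: (halts_mono (T := (m.+1 * (time_bound collect_body + ncost in_m + 14))%N)
     (Q := fun s => J m s /\ unchanged (for_loop vI in_m collect_body) s0 s)) => //; last first.
    by move=> s [h u]; split=> //; apply: inputs_unchanged u in0.
  apply/halts_unchanged/(halts_for (J := J)) => //=.
    by move=> s u; apply: (in_mE (I := I)); apply: inputs_unchanged u in0.
  move=> k s u km kI hk; have is_ : inputs I s by apply: inputs_unchanged u in0.
  apply: halts_run => //= e; rewrite /= /upd /= kI ltnS leq_eqVlt.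
  by case: eqP => [<-|_] //= ek; [rewrite (in_ucost is_)|apply: hk].
move=> s [Js is_]; apply: (halts_mono (halts_run (c := RSet rA in_m (RConst 0)) isT erefl)) => // _ <-.
rewrite /= (in_mE is_); split=> [c [->|[e ->]]|i]; rewrite /= /upd /=.
- by exists m; rewrite ?eqxx -?mn.
- exists e; first by rewrite -mn ltnW // ltnS.
  by rewrite ltn_eqF //= Js.
rewrite -mn ltnS leq_eqVlt; case: eqP => [//|_ /= im].
by rewrite (Js (Ordinal im)) // (valid_ucost valI).
Qed.

Lemma sort_halts s0 : inputs I s0 ->
  halts sort_prog s0 (n * trunc_log 2 n * (4 * sort_time))
    (fun s => candidates (rmem s rA) /\
      forall i j, (i <= j)%N -> (j < n)%N -> (rmem s rA i <= rmem s rA j)%R).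
Proof.
move=> in0; have mn := edges_vertices valI.
have n1 : (1 < n)%N by rewrite -mn ltnS; have [e _] := edge_exists valI; case: m e => // -[].
have log1 : (0 < trunc_log 2 n)%N by rewrite trunc_log_gt0.
pose Q (s : state R) := candidates (rmem s rA) /\
      forall i j, (i <= j)%N -> (j < n)%N -> (rmem s rA i <= rmem s rA j)%R.
pose T0 := (n.+1 * (time_bound collect_body + 30) + 3 +
  (trunc_log 2 n).+2 * (n.+1 * pass_time + bcost (BNLt (nvar vW) in_n)).+1)%N.
apply: (halts_mono (T := T0) (Q := Q)) => //; last first.
  rewrite /T0 /sort_time [bcost _]/=.
  set t1 := time_bound collect_body; set t2 := pass_time; set L := trunc_log 2 n in log1 *.
  (* Since [n] and [L] are positive, [n * L] absorbs the lower-order terms. *)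
  have h1 : (n.+1 <= 2 * (n * L))%N by nia.
  have h2 : (L.+2 * (n.+1 * t2 + 6).+1 <= 3 * L * (2 * n * t2 + 7 * n))%N.
    by apply: leq_mul; [lia|nia].
  have h3 : (3 * L * (2 * n * t2 + 7 * n) = n * L * (6 * t2 + 21))%N by nia.
  have h4 : (n.+1 * (t1 + 30) <= 2 * (n * L) * (t1 + 30))%N by rewrite leq_mul2r h1 orbT.
  have h5 : (0 < n * L)%N by rewrite muln_gt0 log1; lia.
  by move: h2 h4 h5; rewrite h3; lia.
apply: (halts_seq (Q1 := fun s => [/\ inputs I s, candidates (rmem s rA) & nmem s vW 0 = 1%N])).
  apply: halts_seq; first exact/halts_unchanged/(collect_halts in0).
  move=> s1 [h u]; apply: (halts_run (c := nassign vW (NConst 1))) => //.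
  split=> //; apply: inputs_setn => //; exact: inputs_unchanged u in0.
move=> s1 [in1 cand1 sW]; apply: (halts_while (Inv := sort_inv)).
- exists 0%N; split=> //; rewrite ?sW // => t i j h1 h2 h3 h4.
  by have -> : i = j by lia.
- move=> j s u inv /=; have is_ : inputs I s by apply: inputs_unchanged u in1.
  rewrite (in_nE is_) -ltnNge => lt; exact: pass_halts.
move=> j s u [p [pj sW' srt cand]] /=; have is_ : inputs I s by apply: inputs_unchanged u in1.
rewrite (in_nE is_) negbK sW' => np; split=> // i i' ii' i'n.
by apply: (srt 0%N) => //; rewrite mul1n; apply: leq_trans np.
Qed.

End SortProgram.

(** * Binary search for the optimal threshold *)

Local Notation vLow := 35%N (only parsing).
Local Notation vHigh := 36%N (only parsing).
Local Notation vMiddle := 37%N (only parsing).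

Definition load_threshold (i : nexp) : cmd := rassign rC (RGet rA i).
Definition halve : cmd :=
  If is_ok (nassign vHigh (nvar vMiddle))
    (nassign vLow (NAdd (nvar vMiddle) (NConst 1))).
Definition middle : cmd :=
  nassign vMiddle (NHalf (NAdd (nvar vLow) (nvar vHigh)));;
  load_threshold (nvar vMiddle).
Definition search_body : cmd := middle;; test_prog;; halve.
Definition search_prog : cmd :=
  (nassign vLow (NConst 0);; nassign vHigh (NSub in_n (NConst 1)));;
  While (BNLt (nvar vLow) (nvar vHigh)) search_body.
(** The test is repeated at the threshold found, to fill the output array with its
    solution. *)
Definition main_prog : cmd :=
  sort_prog;; path_prog;; search_prog;; load_threshold (nvar vLow);; test_prog;;
  NSet 3 (NConst 0) (nvar vOK).

Definition main_time : nat :=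
  4 * sort_time + 2 * (hang_time in_a (sel_vertex in_b) + time_bound mark_body + 20) +
  20 * (test_time + 50).

Section Main.
Variables (R : realFieldType) (n m : nat) (I : instance R 'I_n 'I_m).
Hypothesis valI : valid I.
Variable A : nat -> R.
Hypothesis candA : candidates I A.
Hypothesis sortedA : forall i j, (i <= j)%N -> (j < n)%N -> (A i <= A j)%R.

Definition ready (s : state R) : Prop :=
  [/\ inputs I s, marked I s & forall i, rmem s rA i = A i].

Lemma ready_unchanged c s s' :
  all (leq 3) (nwrites c) -> all (leq 4) (rwrites c) ->
  21 \notin nwrites c -> rA \notin rwrites c ->
  unchanged c s s' -> ready s -> ready s'.
Proof.
move=> h1 h2 h3 h4 u [r1 r2 r3]; split; first exact: inputs_unchanged u r1.
  by move=> e; rewrite u.1.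
by move=> i; rewrite u.2.
Qed.

(** The interval always contains the least position that passes the test, if there
    is one.  The last position is never tested before the end, which is why it is
    exempt in the last clause; if the search ends there, its test decides
    feasibility. *)
Definition search_inv (j : nat) (s : state R) : Prop :=
  ready s /\ exists lo hi, [/\ nmem s vLow 0 = lo, nmem s vHigh 0 = hi,
    [/\ lo <= hi, hi < n & hi - lo < 2 ^ j]%N,
    forall i, (i < lo)%N -> ~~ test I (A i)
  & hi = n.-1 \/ test I (A hi)].

Lemma search_step j s : search_inv j s -> (nmem s vLow 0 < nmem s vHigh 0)%N ->
  exists2 j', j = j'.+1 &
    halts search_body s (n.+1 * test_time + 50) (search_inv j').
Proof.
case=> rs [lo [hi [slo shi [lohi hin gap] no yes]]]; rewrite slo shi => lt.
case: j gap => [|j] gap; first by move: gap; rewrite expn0; lia.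
exists j => //; pose mid := (lo + hi)./2.
have mid_bounds : (lo <= mid < hi)%N by rewrite /mid; lia.
rewrite expnS in gap.
apply: (halts_mono (T := (time_bound middle + (n.+1 * test_time + time_bound halve))%N)
  (Q := search_inv j)) => //; last by rewrite /=; lia.
apply: halts_seq_run => //.
have us1 := unchanged_run s (isT : loop_free middle).
have s1M : nmem (run middle s) vMiddle 0 = mid by rewrite /= /upd /= slo shi.
have s1C : rmem (run middle s) rC 0 = A mid.
  by rewrite /= /upd /= slo shi; case: rs.
move: (run middle s) => s1 in us1 s1M s1C *.
have rs1 : ready s1 by apply: ready_unchanged us1 rs.
have [in1 mk1 A1] := rs1.
apply: halts_seq; first exact/halts_unchanged/(test_halts valI in1 mk1).
rewrite s1C => s2 [[ok _] us2]; apply: halts_run => //.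
have rs2 : ready s2 by apply: ready_unchanged us2 rs1.
have us3 := unchanged_run s2 (isT : loop_free halve).
split; first by apply: ready_unchanged us3 rs2.
have s2M : nmem s2 vMiddle 0 = mid by rewrite us2.1.
have s2L : nmem s2 vLow 0 = lo by rewrite us2.1 // us1.1.
have s2H : nmem s2 vHigh 0 = hi by rewrite us2.1 // us1.1.
rewrite /= ok lt0b; case: ifP => t; rewrite /= /upd /= s2M ?s2L ?s2H.
  exists lo, mid; split=> //; last by right.
  by split; rewrite /mid in mid_bounds *; lia.
exists (mid + 1)%N, hi; split=> //.
  by split; rewrite /mid in mid_bounds *; lia.
move=> i im; apply: contraFN t; apply: (test_mono valI); apply: sortedA; lia.
Qed.

Lemma search_halts s0 : ready s0 ->
  halts search_prog s0 ((trunc_log 2 n).+2 * (n.+1 * test_time + 60) + 20)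
    (search_inv 0).
Proof.
move=> rs; have mn := edges_vertices valI.
pose start := (nassign vLow (NConst 0);; nassign vHigh (NSub in_n (NConst 1))).
apply: (halts_mono (T := (time_bound start +
    (trunc_log 2 n).+2 * (n.+1 * test_time + 50 + 6).+1)%N) (Q := search_inv 0)) => //; last first.
  by rewrite /= addnC leq_add // leq_mul2l; lia.
have us1 := unchanged_run s0 (isT : loop_free start).
apply: halts_seq_run => //; apply: (halts_while (Inv := search_inv)).
- split; first by apply: ready_unchanged us1 rs.
  have [ins _ _] := rs; rewrite /= /upd /= (in_nE ins).
  exists 0%N, (n - 1)%N; split=> //; last by left; lia.
  split; [lia|lia|]; apply: leq_ltn_trans (_ : n.-1 < _)%N; first by lia.
  by apply: leq_ltn_trans (leq_pred n) _; apply: trunc_log_ltn.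
- by move=> j s u inv /=; rewrite -ltnNge; apply: search_step.
move=> j s u [rs' [lo [hi [slo shi [lohi hin gap] no yes]]]] /=.
rewrite slo shi negbK => hilo; split=> //; exists lo, hi; split=> //.
by split=> //; rewrite expn0; lia.
Qed.

Lemma search_correct s0 s lo : ready s0 -> search_inv 0 s0 -> nmem s0 vLow 0 = lo ->
  nmem s 3 0 = test I (A lo) ->
  (test I (A lo) -> forall e : 'I_m, rmem s rX e = solution I (A lo) e) ->
  correct_output I (bottleneck_hamming I) s.
Proof.
move=> _ [_ [lo' [hi [-> _ [lohi hin gap] no yes]]]] lo'E; rewrite {lo'}lo'E in lohi gap no *.
have hiE : hi = lo by move: gap; rewrite expn0; lia.
rewrite {hi}hiE in hin yes lohi gap *; have [cand pos] := candA.
rewrite /correct_output /out_flag => ->; case t: (test I (A lo)) => sol; [left|right]; split=> //.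
  apply: (test_optimal valI (c := A lo)) => // [|e|c' /cand [i iN <-] ti].
  - exact: pos.
  - exact: sol.
  by apply: sortedA => //; rewrite leqNgt; apply/negP => /no; rewrite ti.
apply: (test_infeasible valI) => c' /cand [i iN <-]; have [/no//|loi] := ltnP i lo.
case: yes => [lon|]; last by rewrite t.
by rewrite (_ : i = lo) ?t //; lia.
Qed.

End Main.

Lemma input_state_inputs (R : realFieldType) n m (I : instance R 'I_n 'I_m) :
  inputs I (input_state I).
Proof. by split. Qed.

(* Valid instances have n >= 2 vertices (two distinct leaves), where
   trunc_log 2 n is positive and of the order of log n, so the bound for all
   sizes is the same as the asymptotic one. *)
Theorem theorem4 (R : realFieldType) :
  exists (p : cmd) (C : nat),
    forall (n m : nat) (I : instance R 'I_n 'I_m), valid I ->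
    exists (s : state R) (t : nat),
      [/\ exec p (input_state I) s t,
          (t <= C * (n * trunc_log 2 n))%N
        & correct_output I (bottleneck_hamming I) s].
Proof.
exists main_prog, main_time => n m I valI.
suff [s [t [e le h]]] : halts main_prog (input_state I) (main_time * (n * trunc_log 2 n))
    (correct_output I (bottleneck_hamming I)) by exists s, t.
have in0 := input_state_inputs I; have mn := edges_vertices valI.
have n1 : (1 < n)%N by rewrite -mn ltnS; have [e _] := edge_exists valI; case: m e {I valI in0 mn} => // -[].
have log1 : (0 < trunc_log 2 n)%N by rewrite trunc_log_gt0.
pose Q := correct_output I (bottleneck_hamming I).
pose T0 := (n * trunc_log 2 n * (4 * sort_time) +
  (n.+1 * (hang_time in_a (sel_vertex in_b) + time_bound mark_body + 20) +
  ((trunc_log 2 n).+2 * (n.+1 * test_time + 60) + 20 +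
  (time_bound (load_threshold (nvar vLow)) + (n.+1 * test_time + 4)))))%N.
apply: (halts_mono (T := T0) (Q := Q)) => //; last first.
  rewrite /T0 /main_time [time_bound (load_threshold _)]/=.
  move: sort_time test_time (_ + 20)%N (trunc_log 2 n) log1 => t1 t2 t3 L log1.
  (* Since [n] and [L] are positive, [n * L] absorbs the lower-order terms. *)
  have h1 : (n.+1 * t3 <= 2 * (n * L) * t3)%N by rewrite leq_mul2r; apply/orP; right; nia.
  have h2 : (L.+2 * (n.+1 * t2 + 60) <= 3 * L * (2 * n * t2 + 60 * n))%N.
    by apply: leq_mul; [lia|nia].
  have h3 : (n.+1 * t2 <= 2 * (n * L) * t2)%N by rewrite leq_mul2r; apply/orP; right; nia.
  have h5 : (0 < n * L)%N by rewrite muln_gt0 log1; lia.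
  by move: h1 h2 h3 h5; lia.
apply: halts_seq; first exact/halts_unchanged/(sort_halts valI in0).
move=> s1 [[cand srt] u1]; have in1 : inputs I s1 by apply: inputs_unchanged u1 in0.
set A := rmem s1 5 in cand srt.
apply: halts_seq; first exact/halts_unchanged/(path_halts valI in1).
move=> s2 [mk2 u2].
have rs2 : ready I A s2.
  by split=> // [|i]; [apply: inputs_unchanged u2 in1|rewrite u2.2].
apply: halts_seq; first exact/halts_unchanged/(search_halts valI srt rs2).
move=> s3 [inv3 u3].
have rs3 : ready I A s3 by apply: ready_unchanged u3 rs2.
have us4 := unchanged_run s3 (isT : loop_free (load_threshold (nvar vLow))).
have s4C : rmem (run (load_threshold (nvar vLow)) s3) rC 0 = A (nmem s3 vLow 0).
  by case: rs3 => _ _ <-.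
apply: halts_seq_run => //.
move: (run _ s3) => s4 in us4 s4C *.
have [in4 mk4 _] : ready I A s4 by apply: ready_unchanged us4 rs3.
apply: halts_seq; first exact: (test_halts valI in4 mk4).
rewrite s4C => s5 [ok5 sol5].
apply: (halts_run (c := NSet 3 (NConst 0) (nvar vOK))) => //.
by apply: (search_correct valI cand srt rs3 inv3 (erefl _)).
Qed.
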